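(* Every cyclic $\dagger$-$*$-autonomous category is a conjugative $*$-autonomous category; that is, if $\mathbb{X}$ is a cyclic $\dagger$-$*$-autonomous category, then $\mathbb{X}$ admits a conjugation making it a conjugative LDC (which is $*$-autonomous).
   Context: Composition is written in diagrammatic order ($fg$ means first $f$, then $g$). A linearly distributive category (LDC, in the sense of Cockett--Seely) is a category $\mathbb{X}$ with two monoidal structures $(\otimes,\top,a_\otimes,u_\otimes^L,u_\otimes^R)$ and $(\oplus,\bot,a_\oplus,u_\oplus^L,u_\oplus^R)$ and natural transformations $\partial^L:A\otimes(B\oplus C)\to(A\otimes B)\oplus C$, $\partial^R:(B\oplus C)\otimes A\to B\oplus(C\otimes A)$ satisfying the standard coherence conditions with the associators and unitors; here $a:(AB)C\to A(BC)$, $u^L_\otimes:\top\otimes A\to A$, $u^R_\otimes:A\otimes\top\to A$, and likewise for $\oplus$. **Duals.** A linear dual $(\eta,\epsilon):B\dashv\!\!\!\dashv A$ ($B$ is left dual to $A$, $A$ is right dual to $B$) consists of $\eta:\top\to B\oplus A$, $\epsilon:A\otimes B\to\bot$ with $(u^L_\otimes)^{-1}(\eta\otimes1)\partial^R(1\oplus\epsilon)u^R_\oplus=1_B$ and $(u^R_\otimes)^{-1}(1\otimes\eta)\partial^L(\epsilon\oplus1)u^L_\oplus=1_A$. Any two left (right) duals of an object are canonically isomorphic: for $(\eta,\epsilon):B\dashv\!\!\!\dashv A$ and $(\eta',\epsilon'):C\dashv\!\!\!\dashv A$ the isomorphism $B\to C$ is $(u^L_\otimes)^{-1}(\eta'\otimes1)\partial^R(1\oplus\epsilon)u^R_\oplus$;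 similarly for right duals. An LDC is $*$-autonomous if every object $A$ has a chosen left dual $A^*\dashv\!\!\!\dashv A$ and a chosen right dual $A\dashv\!\!\!\dashv{}^*\!A$; $(\_)^*$ and ${}^*(\_)$ are then contravariant functors. **Cyclor.** A cyclor on a $*$-autonomous category is a natural isomorphism $\psi_A:A^*\to{}^*\!A$ compatible with the canonical isomorphisms: (C.1) $\psi_\bot$ commutes with the canonical isomorphisms $\bot^*\cong\top\cong{}^*\bot$; (C.2) $\eta_A(\psi_A)^*\psi_{A^*}=\eta'_A$ where $\eta_A:A\to({}^*\!A)^*$ and $\eta'_A:A\to{}^*(A^* )$ are the canonical isomorphisms; (C.3) $\psi_\top$ commutes with $\top^*\cong\bot\cong{}^*\top$; (C.4) $\psi_{A\otimes B}$ corresponds to $\psi_B\oplus\psi_A$ under $(A\otimes B)^*\cong B^*\oplus A^*$, ${}^*(A\otimes B)\cong{}^*\!B\oplus{}^*\!A$; (C.5) $\psi_{A\oplus B}$ corresponds to $\psi_B\otimes\psi_A$ under $(A\oplus B)^*\cong B^*\otimes A^*$, ${}^*(A\oplus B)\cong{}^*\!B\otimes{}^*\!A$. **Dagger.** A $\dagger$-LDC is an LDC with a functor $(\_)^\dagger:\mathbb{X}^{op}\to\mathbb{X}$ and natural isomorphisms $\lambda_\otimes:A^\dagger\otimes B^\dagger\to(A\oplus B)^\dagger$, $\lambda_\oplus:A^\dagger\oplus B^\dagger\to(A\otimes B)^\dagger$, $\lambda_\top:\top\to\bot^\dagger$, $\lambda_\bot:\bot\to\top^\dagger$, $\iota:A\to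 A^{\dagger\dagger}$ such that (1) $(1\otimes\lambda_\otimes)\lambda_\otimes a_\oplus^\dagger=a_\otimes^{-1}(\lambda_\otimes\otimes1)\lambda_\otimes$ and $(1\oplus\lambda_\oplus)\lambda_\oplus a_\otimes^\dagger=a_\oplus^{-1}(\lambda_\oplus\oplus1)\lambda_\oplus$; (2) $(\lambda_\top\otimes1)\lambda_\otimes=u^L_\otimes(u^L_\oplus)^\dagger$, $(1\otimes\lambda_\top)\lambda_\otimes=u^R_\otimes(u^R_\oplus)^\dagger$, $(\lambda_\bot\oplus1)\lambda_\oplus=u^L_\oplus(u^L_\otimes)^\dagger$, $(1\oplus\lambda_\bot)\lambda_\oplus=u^R_\oplus(u^R_\otimes)^\dagger$; (3) $\partial^L(\lambda_\otimes\oplus1)\lambda_\oplus=(1\otimes\lambda_\oplus)\lambda_\otimes(\partial^R)^\dagger$ and $\partial^R(1\oplus\lambda_\otimes)\lambda_\oplus=(\lambda_\oplus\otimes1)\lambda_\otimes(\partial^L)^\dagger$; (4) $\iota\lambda_\otimes^\dagger=(\iota\oplus\iota)\lambda_\oplus$ and $\iota\lambda_\oplus^\dagger=(\iota\otimes\iota)\lambda_\otimes$; (5) $\iota_\bot\lambda_\top^\dagger=\lambda_\bot$ and $\iota_\top\lambda_\bot^\dagger=\lambda_\top$; (6) $\iota_{A^\dagger}=(\iota_A^{-1})^\dagger$. If $(\eta,\epsilon):A\dashv\!\!\!\dashv B$ then $(\lambda_\top\epsilon^\dagger\lambda_\oplus^{-1},\lambda_\otimes\eta^\dagger\lambda_\bot^{-1}):B^\dagger\dashv\!\!\!\dashv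 A^\dagger$; hence $({}^*\!A)^\dagger$ is a left dual and $(A^* )^\dagger$ a right dual of $A^\dagger$. A cyclic $\dagger$-$*$-autonomous category is a $\dagger$-LDC which is $*$-autonomous and has a cyclor $\psi$ preserved by the dagger: $({}^*\!A)^\dagger\xrightarrow{\psi_A^\dagger}(A^* )^\dagger\cong{}^*(A^\dagger)$ equals $({}^*\!A)^\dagger\cong(A^\dagger)^*\xrightarrow{\psi_{A^\dagger}}{}^*(A^\dagger)$, with the canonical isomorphisms of duals. **Conjugation.** A conjugative LDC is an LDC with a (covariant) functor $\overline{(\_)}:\mathbb{X}\to\mathbb{X}$ and natural isomorphisms $\chi_\otimes:\overline A\otimes\overline B\to\overline{B\otimes A}$, $\chi_\oplus:\overline{A\oplus B}\to\overline B\oplus\overline A$, $\varepsilon_A:\overline{\overline A}\to A$ such that $\overline{\varepsilon_A}=\varepsilon_{\overline A}$; $a_\otimes(1\otimes\chi_\otimes)\chi_\otimes=(\chi_\otimes\otimes1)\chi_\otimes\overline{a_\otimes^{-1}}$; $\chi_\otimes\overline{\chi_\otimes}\varepsilon=\varepsilon\otimes\varepsilon$; the same two equations hold with $(\oplus,\chi_\oplus^{-1})$ in place of $(\otimes,\chi_\otimes)$; and $(\chi_\oplus\otimes1)\partial^R(1\oplus\chi_\otimes)=\chi_\otimes\overline{\partial^L}\chi_\oplus:\overline{B\oplus C}\otimes\overline A\to\overline C\oplus\overline{A\otimes B}$, $(1\otimes\chi_\oplus)\partial^L(\chi_\otimes\oplus1)=\chi_\otimes\overline{\partial^R}\chi_\oplus:\overline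 A\otimes\overline{C\oplus B}\to\overline{B\otimes A}\oplus\overline C$. A conjugative $*$-autonomous category is a conjugative LDC that is $*$-autonomous. *)

(* Defs.v *)
Set Implicit Arguments.
Unset Strict Implicit.
Unset Printing Implicit Defensive.

Declare Scope hom_scope.
Delimit Scope hom_scope with hom.
Open Scope hom_scope.

Reserved Notation "f · g" (at level 40, left associativity).
Reserved Notation "i ⁻¹" (at level 1, left associativity, format "i ⁻¹").
Reserved Notation "A ⊗ B" (at level 35, no associativity).
Reserved Notation "A ⊕ B" (at level 35, no associativity).
Reserved Notation "f ⊗₁ g" (at level 35, no associativity).
Reserved Notation "f ⊕₁ g" (at level 35, no associativity).

Record category : Type := Category {
  ob :> Type;
  hom : ob -> ob -> Type;
  idm : forall A : ob, hom A A;
  (* Composition is in diagrammatic order throughout. *)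
  comp : forall A B C : ob, hom A B -> hom B C -> hom A C;
  comp_idl : forall (A B : ob) (f : hom A B), comp (idm A) f = f;
  comp_idr : forall (A B : ob) (f : hom A B), comp f (idm B) = f;
  comp_assoc : forall (A B C D : ob) (f : hom A B) (g : hom B C) (h : hom C D),
    comp (comp f g) h = comp f (comp g h)
}.

Arguments hom {c} A B.
Arguments idm {c} A.
Arguments comp {c A B C} f g.

Notation "f · g" := (comp f g) : hom_scope.
Notation "1" := (idm _) : hom_scope.

Record iso (C : category) (A B : C) : Type := Iso {
  fwd :> hom A B;
  bwd : hom B A;
  fwd_bwd : fwd · bwd = 1;
  bwd_fwd : bwd · fwd = 1
}.

Arguments iso {C} A B.

Notation "i ⁻¹" := (bwd i) : hom_scope.

Record monoidal (C : category) : Type := Monoidal {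
  unit : C;
  tens : C -> C -> C;
  tmap : forall A A' B B' : C, hom A A' -> hom B B' -> hom (tens A B) (tens A' B');
  assoc : forall A B D : C, iso (tens (tens A B) D) (tens A (tens B D));
  lunit : forall A : C, iso (tens unit A) A;
  runit : forall A : C, iso (tens A unit) A;

  tmap_id : forall A B : C, tmap (idm A) (idm B) = 1;
  tmap_comp : forall (A A' A'' B B' B'' : C)
      (f : hom A A') (f' : hom A' A'') (g : hom B B') (g' : hom B' B''),
    tmap (f · f') (g · g') = tmap f g · tmap f' g';
  assoc_nat : forall (A A' B B' D D' : C)
      (f : hom A A') (g : hom B B') (h : hom D D'),
    tmap (tmap f g) h · assoc A' B' D' = assoc A B D · tmap f (tmap g h);
  lunit_nat : forall (A A' : C) (f : hom A A'),
    tmap (idm unit) f · lunit A' = lunit A · f;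
  runit_nat : forall (A A' : C) (f : hom A A'),
    tmap f (idm unit) · runit A' = runit A · f;
  pentagon : forall A B D E : C,
    assoc (tens A B) D E · assoc A B (tens D E)
    = tmap (assoc A B D) (idm E) · assoc A (tens B D) E
      · tmap (idm A) (assoc B D E);
  triangle : forall A B : C,
    assoc A unit B · tmap (idm A) (lunit B) = tmap (runit A) (idm B)
}.

Arguments unit {C} m.
Arguments tens {C} m A B.
Arguments tmap {C} m {A A' B B'} f g.
Arguments assoc {C} m A B D.
Arguments lunit {C} m A.
Arguments runit {C} m A.

Record bimonoidal : Type := Bimonoidal {
  bim_cat :> category;
  tensor : monoidal bim_cat;
  par : monoidal bim_cat
}.

Arguments tensor {b}.
Arguments par {b}.

Notation "⊤" := (unit tensor) : hom_scope.
Notation "⊥" := (unit par) : hom_scope.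
Notation "A ⊗ B" := (tens tensor A B) : hom_scope.
Notation "A ⊕ B" := (tens par A B) : hom_scope.
Notation "f ⊗₁ g" := (tmap tensor f g) : hom_scope.
Notation "f ⊕₁ g" := (tmap par f g) : hom_scope.
Notation aT := (assoc tensor).
Notation uLT := (lunit tensor).
Notation uRT := (runit tensor).
Notation aP := (assoc par).
Notation uLP := (lunit par).
Notation uRP := (runit par).

Record ldc : Type := LDC {
  ldc_bim :> bimonoidal;
  dL : forall A B C : ldc_bim, hom (A ⊗ (B ⊕ C)) ((A ⊗ B) ⊕ C);
  dR : forall A B C : ldc_bim, hom ((A ⊕ B) ⊗ C) (A ⊕ (B ⊗ C));
  dL_nat : forall (A A' B B' C C' : ldc_bim)
      (f : hom A A') (g : hom B B') (h : hom C C'),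
    (f ⊗₁ (g ⊕₁ h)) · dL A' B' C' = dL A B C · ((f ⊗₁ g) ⊕₁ h);
  dR_nat : forall (A A' B B' C C' : ldc_bim)
      (f : hom A A') (g : hom B B') (h : hom C C'),
    ((f ⊕₁ g) ⊗₁ h) · dR A' B' C' = dR A B C · (f ⊕₁ (g ⊗₁ h));

  dL_uLT : forall A B : ldc_bim, dL ⊤ A B · (uLT A ⊕₁ 1) = uLT (A ⊕ B);
  dR_uRT : forall A B : ldc_bim, dR A B ⊤ · (1 ⊕₁ uRT B) = uRT (A ⊕ B);
  dL_uRP : forall A B : ldc_bim, dL A B ⊥ · uRP (A ⊗ B) = 1 ⊗₁ uRP B;
  dR_uLP : forall A B : ldc_bim, dR ⊥ A B · uLP (A ⊗ B) = uLP A ⊗₁ 1;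

  dL_aT : forall A B C D : ldc_bim,
    dL (A ⊗ B) C D · (aT A B C ⊕₁ 1)
    = aT A B (C ⊕ D) · (1 ⊗₁ dL B C D) · dL A (B ⊗ C) D;
  dR_aT : forall A B C D : ldc_bim,
    aT (A ⊕ B) C D · dR A B (C ⊗ D)
    = (dR A B C ⊗₁ 1) · dR A (B ⊗ C) D · (1 ⊕₁ aT B C D);
  dL_aP : forall A B C D : ldc_bim,
    (1 ⊗₁ aP B C D) · dL A B (C ⊕ D)
    = dL A (B ⊕ C) D · (dL A B C ⊕₁ 1) · aP (A ⊗ B) C D;
  dR_aP : forall A B C D : ldc_bim,
    dR (A ⊕ B) C D · aP A B (C ⊗ D)
    = (aP A B C ⊗₁ 1) · dR A (B ⊕ C) D · (1 ⊕₁ dR B C D);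

  dL_dR_aT : forall A B C D : ldc_bim,
    (dL A B C ⊗₁ 1) · dR (A ⊗ B) C D
    = aT A (B ⊕ C) D · (1 ⊗₁ dR B C D) · dL A B (C ⊗ D);
  dL_dR_aP : forall A B C D : ldc_bim,
    dL (A ⊕ B) C D · (dR A B C ⊕₁ 1) · aP A (B ⊗ C) D
    = dR A B (C ⊕ D) · (1 ⊕₁ dL B C D)
}.

Arguments dL {l} A B C.
Arguments dR {l} A B C.

(* [dual_pair B A]: the maps of a linear dual with [B] on the left and [A] on
   the right; [linear_dual B A] adds the two triangle identities. *)
Record dual_pair (X : ldc) (B A : X) : Type := DualPair {
  eta : hom ⊤ (B ⊕ A);
  eps : hom (A ⊗ B) ⊥
}.

Record linear_dual (X : ldc) (B A : X) : Type := LinearDual {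
  dual_maps :> dual_pair B A;
  dual_left : (uLT B)⁻¹ · (eta dual_maps ⊗₁ 1) · dR B A B
              · (1 ⊕₁ eps dual_maps) · uRP B = 1;
  dual_right : (uRT A)⁻¹ · (1 ⊗₁ eta dual_maps) · dL A B A
               · (eps dual_maps ⊕₁ 1) · uLP A = 1
}.

(* For [f : A -> A'], the induced map from a left dual of [A'] to a left dual
   of [A]; between chosen duals this is the contravariant action of the functor
   on maps. *)
Definition left_mate (X : ldc) (B B' A A' : X)
    (d : dual_pair B A) (d' : dual_pair B' A') (f : hom A A') : hom B' B :=
  (uLT B')⁻¹ · (eta d ⊗₁ 1) · ((1 ⊕₁ f) ⊗₁ 1) · dR B A' B'
  · (1 ⊕₁ eps d') · uRP B.

Definition right_mate (X : ldc) (B B' A A' : X)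
    (d : dual_pair B A) (d' : dual_pair B' A') (f : hom B B') : hom A' A :=
  (uRT A')⁻¹ · (1 ⊗₁ eta d) · (1 ⊗₁ (f ⊕₁ 1)) · dL A' B' A
  · (eps d' ⊕₁ 1) · uLP A.

Definition left_dual_iso (X : ldc) (A B C : X)
    (d : dual_pair B A) (d' : dual_pair C A) : hom B C :=
  (uLT B)⁻¹ · (eta d' ⊗₁ 1) · dR C A B · (1 ⊕₁ eps d) · uRP C.

Definition right_dual_iso (X : ldc) (A B C : X)
    (d : dual_pair A B) (d' : dual_pair A C) : hom B C :=
  (uRT B)⁻¹ · (1 ⊗₁ eta d') · dL B A C · (eps d ⊕₁ 1) · uLP C.

(* Canonical duality data: the unit objects are dual to each other, and the
   duals [P] of [A] and [Q] of [B] give duals [Q ⊕ P] of [A ⊗ B] and [Q ⊗ P]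
   of [A ⊕ B]. As [P] and [A] are arbitrary, [tens_pair] and [par_pair] also
   cover right duals, read from the other side. *)
Definition top_bot_pair (X : ldc) : @dual_pair X ⊤ ⊥ :=
  DualPair ((uRP ⊤)⁻¹) (uRT ⊥).

Definition bot_top_pair (X : ldc) : @dual_pair X ⊥ ⊤ :=
  DualPair ((uLP ⊤)⁻¹) (uLT ⊥).

Definition tens_pair (X : ldc) (A B P Q : X)
    (dA : dual_pair P A) (dB : dual_pair Q B) : dual_pair (Q ⊕ P) (A ⊗ B) :=
  DualPair
    (eta dB · (1 ⊕₁ ((uLT B)⁻¹ · (eta dA ⊗₁ 1) · dR P A B))
     · (aP Q P (A ⊗ B))⁻¹)
    (aT A B (Q ⊕ P)
     · (1 ⊗₁ (dL B Q P · (eps dB ⊕₁ 1) · uLP P)) · eps dA).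

Definition par_pair (X : ldc) (A B P Q : X)
    (dA : dual_pair P A) (dB : dual_pair Q B) : dual_pair (Q ⊗ P) (A ⊕ B) :=
  DualPair
    (eta dB · (((uRT Q)⁻¹ · (1 ⊗₁ eta dA) · dL Q P A) ⊕₁ 1)
     · aP (Q ⊗ P) A B)
    ((aT (A ⊕ B) Q P)⁻¹
     · ((dR A B Q · (1 ⊕₁ eps dB) · uRP A) ⊗₁ 1) · eps dA).

Record star_autonomous (X : ldc) : Type := StarAutonomous {
  lstar : X -> X;
  rstar : X -> X;
  lstar_dual : forall A : X, linear_dual (lstar A) A;
  rstar_dual : forall A : X, linear_dual A (rstar A)
}.

Definition lstar_map (X : ldc) (S : star_autonomous X) (A B : X) (f : hom A B)
    : hom (lstar S B) (lstar S A) :=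
  left_mate (lstar_dual S A) (lstar_dual S B) f.

Definition rstar_map (X : ldc) (S : star_autonomous X) (A B : X) (f : hom A B)
    : hom (rstar S B) (rstar S A) :=
  right_mate (rstar_dual S A) (rstar_dual S B) f.

Record cyclor (X : ldc) (S : star_autonomous X) : Type := Cyclor {
  psi : forall A : X, iso (lstar S A) (rstar S A);
  psi_nat : forall (A B : X) (f : hom A B),
    lstar_map S f · psi A = psi B · rstar_map S f;
  psi_bot :
    psi ⊥ · right_dual_iso (rstar_dual S ⊥) (bot_top_pair X)
    = left_dual_iso (lstar_dual S ⊥) (top_bot_pair X);
  psi_psi : forall A : X,
    left_dual_iso (rstar_dual S A) (lstar_dual S (rstar S A))
      · lstar_map S (psi A) · psi (lstar S A)
    = right_dual_iso (lstar_dual S A) (rstar_dual S (lstar S A));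
  psi_top :
    psi ⊤ · right_dual_iso (rstar_dual S ⊤) (top_bot_pair X)
    = left_dual_iso (lstar_dual S ⊤) (bot_top_pair X);
  psi_tens : forall A B : X,
    left_dual_iso (lstar_dual S (A ⊗ B))
        (tens_pair (lstar_dual S A) (lstar_dual S B))
      · (psi B ⊕₁ psi A)
    = psi (A ⊗ B)
      · right_dual_iso (rstar_dual S (A ⊗ B))
          (par_pair (rstar_dual S B) (rstar_dual S A));
  psi_par : forall A B : X,
    left_dual_iso (lstar_dual S (A ⊕ B))
        (par_pair (lstar_dual S A) (lstar_dual S B))
      · (psi B ⊗₁ psi A)
    = psi (A ⊕ B)
      · right_dual_iso (rstar_dual S (A ⊕ B))
          (tens_pair (rstar_dual S B) (rstar_dual S A))
}.

Record dagger (X : ldc) : Type := Dagger {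
  dag : X -> X;
  dag_map : forall A B : X, hom A B -> hom (dag B) (dag A);
  dag_id : forall A : X, dag_map (idm A) = 1;
  dag_comp : forall (A B C : X) (f : hom A B) (g : hom B C),
    dag_map (f · g) = dag_map g · dag_map f;

  lamT : forall A B : X, iso (dag A ⊗ dag B) (dag (A ⊕ B));
  lamP : forall A B : X, iso (dag A ⊕ dag B) (dag (A ⊗ B));
  lam_top : iso ⊤ (dag ⊥);
  lam_bot : iso ⊥ (dag ⊤);
  iota : forall A : X, iso A (dag (dag A));

  lamT_nat : forall (A A' B B' : X) (f : hom A A') (g : hom B B'),
    (dag_map f ⊗₁ dag_map g) · lamT A B = lamT A' B' · dag_map (f ⊕₁ g);
  lamP_nat : forall (A A' B B' : X) (f : hom A A') (g : hom B B'),
    (dag_map f ⊕₁ dag_map g) · lamP A B = lamP A' B' · dag_map (f ⊗₁ g);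
  iota_nat : forall (A B : X) (f : hom A B),
    f · iota B = iota A · dag_map (dag_map f);

  lamT_assoc : forall A B C : X,
    (1 ⊗₁ lamT B C) · lamT A (B ⊕ C) · dag_map (aP A B C)
    = (aT (dag A) (dag B) (dag C))⁻¹ · (lamT A B ⊗₁ 1) · lamT (A ⊕ B) C;
  lamP_assoc : forall A B C : X,
    (1 ⊕₁ lamP B C) · lamP A (B ⊗ C) · dag_map (aT A B C)
    = (aP (dag A) (dag B) (dag C))⁻¹ · (lamP A B ⊕₁ 1) · lamP (A ⊗ B) C;
  lamT_lunit : forall A : X,
    (lam_top ⊗₁ 1) · lamT ⊥ A = uLT (dag A) · dag_map (uLP A);
  lamT_runit : forall A : X,
    (1 ⊗₁ lam_top) · lamT A ⊥ = uRT (dag A) · dag_map (uRP A);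
  lamP_lunit : forall A : X,
    (lam_bot ⊕₁ 1) · lamP ⊤ A = uLP (dag A) · dag_map (uLT A);
  lamP_runit : forall A : X,
    (1 ⊕₁ lam_bot) · lamP A ⊤ = uRP (dag A) · dag_map (uRT A);
  lam_dL : forall A B C : X,
    dL (dag A) (dag B) (dag C) · (lamT A B ⊕₁ 1) · lamP (A ⊕ B) C
    = (1 ⊗₁ lamP B C) · lamT A (B ⊗ C) · dag_map (dR A B C);
  lam_dR : forall A B C : X,
    dR (dag B) (dag C) (dag A) · (1 ⊕₁ lamT C A) · lamP B (C ⊕ A)
    = (lamP B C ⊗₁ 1) · lamT (B ⊗ C) A · dag_map (dL B C A);
  iota_lamT : forall A B : X,
    iota (A ⊕ B) · dag_map (lamT A B)
    = (iota A ⊕₁ iota B) · lamP (dag A) (dag B);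
  iota_lamP : forall A B : X,
    iota (A ⊗ B) · dag_map (lamP A B)
    = (iota A ⊗₁ iota B) · lamT (dag A) (dag B);
  iota_bot : iota ⊥ · dag_map lam_top = lam_bot;
  iota_top : iota ⊤ · dag_map lam_bot = lam_top;
  iota_dag : forall A : X, fwd (iota (dag A)) = dag_map ((iota A)⁻¹)
}.

Definition dag_pair (X : ldc) (D : dagger X) (A B : X) (d : dual_pair A B)
    : dual_pair (dag D B) (dag D A) :=
  DualPair
    (lam_top D · dag_map D (eps d) · (lamP D B A)⁻¹)
    (lamT D A B · dag_map D (eta d) · (lam_bot D)⁻¹).

Definition dagger_preserves_cyclor (X : ldc) (S : star_autonomous X)
    (D : dagger X) (c : cyclor S) : Prop :=
  forall A : X,
    dag_map D (psi c A)
      · right_dual_iso (dag_pair D (lstar_dual S A)) (rstar_dual S (dag D A))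
    = left_dual_iso (dag_pair D (rstar_dual S A)) (lstar_dual S (dag D A))
      · psi c (dag D A).

Record cyclic_dagger_star_autonomous (X : ldc) : Type :=
  CyclicDaggerStarAutonomous {
    cdsa_dagger : dagger X;
    cdsa_star : star_autonomous X;
    cdsa_cyclor : cyclor cdsa_star;
    cdsa_preserves : dagger_preserves_cyclor cdsa_dagger cdsa_cyclor
  }.

Record conjugation (X : ldc) : Type := Conjugation {
  conj : X -> X;
  conj_map : forall A B : X, hom A B -> hom (conj A) (conj B);
  conj_id : forall A : X, conj_map (idm A) = 1;
  conj_comp : forall (A B C : X) (f : hom A B) (g : hom B C),
    conj_map (f · g) = conj_map f · conj_map g;

  chiT : forall A B : X, iso (conj A ⊗ conj B) (conj (B ⊗ A));
  chiP : forall A B : X, iso (conj (A ⊕ B)) (conj B ⊕ conj A);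
  conj_eps : forall A : X, iso (conj (conj A)) A;

  chiT_nat : forall (A A' B B' : X) (f : hom A A') (g : hom B B'),
    (conj_map f ⊗₁ conj_map g) · chiT A' B' = chiT A B · conj_map (g ⊗₁ f);
  chiP_nat : forall (A A' B B' : X) (f : hom A A') (g : hom B B'),
    conj_map (f ⊕₁ g) · chiP A' B' = chiP A B · (conj_map g ⊕₁ conj_map f);
  conj_eps_nat : forall (A B : X) (f : hom A B),
    conj_map (conj_map f) · conj_eps B = conj_eps A · f;

  conj_eps_conj : forall A : X, conj_map (conj_eps A) = conj_eps (conj A);
  chiT_assoc : forall A B C : X,
    aT (conj A) (conj B) (conj C) · (1 ⊗₁ chiT B C) · chiT A (C ⊗ B)
    = (chiT A B ⊗₁ 1) · chiT (B ⊗ A) C · conj_map ((aT C B A)⁻¹);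
  chiT_eps : forall A B : X,
    chiT (conj A) (conj B) · conj_map (chiT B A) · conj_eps (A ⊗ B)
    = conj_eps A ⊗₁ conj_eps B;
  chiP_assoc : forall A B C : X,
    aP (conj A) (conj B) (conj C) · (1 ⊕₁ (chiP C B)⁻¹) · (chiP (C ⊕ B) A)⁻¹
    = ((chiP B A)⁻¹ ⊕₁ 1) · (chiP C (B ⊕ A))⁻¹ · conj_map ((aP C B A)⁻¹);
  chiP_eps : forall A B : X,
    (chiP (conj B) (conj A))⁻¹ · conj_map ((chiP A B)⁻¹) · conj_eps (A ⊕ B)
    = conj_eps A ⊕₁ conj_eps B;
  chi_dR : forall A B C : X,
    (chiP B C ⊗₁ 1) · dR (conj C) (conj B) (conj A) · (1 ⊕₁ chiT B A)
    = chiT (B ⊕ C) A · conj_map (dL A B C) · chiP (A ⊗ B) C;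
  chi_dL : forall A B C : X,
    (1 ⊗₁ chiP C B) · dL (conj A) (conj B) (conj C) · (chiT A B ⊕₁ 1)
    = chiT A (C ⊕ B) · conj_map (dR C B A) · chiP C (B ⊗ A)
}.

Record conjugative_star_autonomous (X : ldc) : Type :=
  ConjugativeStarAutonomous {
    csa_conj : conjugation X;
    csa_star : star_autonomous X
  }.

(* Main.v *)
Require Import Defs.
From Corelib Require Import ssreflect ssrfun.

(** The conjugate of [A] is [(L A)†], the dagger of its left dual [L A]. Left
    dual and dagger are both contravariant and both exchange tensor and par; the
    left dual also reverses the order of the factors and the dagger keeps it.
    The composite is therefore covariant, preserves tensor and par, and
    reverses their order. Its comparison maps combine those of the dagger with
    the canonical isomorphisms [L (A ⊗ B) ≅ L B ⊕ L A] and
    [L (A ⊕ B) ≅ L B ⊗ L A]. The involution comes from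
    [A ≅ A†† ≅ (L ((L A)†))†]: the first map is [iota], and the second is the
    dagger of the canonical isomorphism between two left duals of [(L A)†],
    namely the chosen one and [A†].

    Every coherence law of the conjugation unfolds to the matching law of the
    dagger and an equation between maps of left duals. These equations all
    have one proof. Call [m : P' -> P] a mate of [f : A -> A'] when
    [(1 ⊗ m) eps = (f ⊗ 1) eps'] (predicate [mates]). A map has at most one
    mate for given duals ([mates_unique]), mates compose ([mates_comp]), and
    every map in the equations is a mate of an evident map: canonical
    isomorphisms are mates of identities, if [m] and [n] are mates of
    [f] and [g] then [n ⊕ m] is a mate of [f ⊗ g] ([mates_tens]), the associator of tensor has that of par ([mates_assoc]),
    [dL] has [dL] ([mates_dL]), the dagger turns a mate pair around
    ([mates_dag]), [lamT] has the inverse of [lamP] as a mate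
    ([mates_lam]), and [iota] is a mate of its own inverse ([mates_iota]). So
    an equation holds as soon as both sides are mates of the same map.

    The facts about [mates] rest on the adjunction [A ⊗ -] ⊣ [P ⊕ -] that a
    dual [P] of [A] provides ([coev_ev], [coev_ev_par]); the dual
    [tens_pair d e] of a tensor product is the composite of two such
    adjunctions ([ev_tens_pair], [coev_tens_pair]). Statements about par follow
    from those about tensor by reading them in the LDC in which both tensors
    are reversed ([ldc_rev]): a left dual becomes a right dual there, and
    [par_pair] becomes [tens_pair]. *)

Set Implicit Arguments.
Unset Strict Implicit.
Unset Printing Implicit Defensive.

(** * Composition and isomorphisms *)

Section Composition.
Variable C : category.

(** Rewrites with [f · g = h] inside a composite that is nested to the right,
    the normal form in which composites are kept below. *)
Lemma comp_under (A B D : C) (f : hom A B) (g : hom B D) (h : hom A D) :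
  f · g = h -> forall (E : C) (k : hom D E), f · (g · k) = h · k.
Proof. by move=> <- E k; rewrite comp_assoc. Qed.

Lemma iso_cancel_l (A B D : C) (i : iso A B) (f g : hom B D) :
  i · f = i · g -> f = g.
Proof.
by move=> e; rewrite -(comp_idl f) -(comp_idl g) -(bwd_fwd i) !comp_assoc e.
Qed.

Lemma iso_cancel_r (A B D : C) (i : iso B D) (f g : hom A B) :
  f · i = g · i -> f = g.
Proof.
by move=> e; rewrite -(comp_idr f) -(comp_idr g) -(fwd_bwd i) -!comp_assoc e.
Qed.

Lemma iso_move_l (A B D : C) (i : iso A B) (f : hom B D) (g : hom A D) :
  i · f = g -> f = i⁻¹ · g.
Proof. by move=> <-; rewrite -comp_assoc bwd_fwd comp_idl. Qed.

Lemma iso_move_r (A B D : C) (i : iso B D) (f : hom A B) (g : hom A D) :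
  f · i = g -> f = g · i⁻¹.
Proof. by move=> <-; rewrite comp_assoc fwd_bwd comp_idr. Qed.

Lemma fwd_bwd_under (A B D : C) (i : iso A B) (f : hom A D) : i · (i⁻¹ · f) = f.
Proof. by rewrite -comp_assoc fwd_bwd comp_idl. Qed.

Lemma bwd_fwd_under (A B D : C) (i : iso A B) (f : hom B D) : i⁻¹ · (i · f) = f.
Proof. by rewrite -comp_assoc bwd_fwd comp_idl. Qed.

Lemma iso_inv_square (A B A' B' : C) (i : iso A B) (j : iso A' B')
    (f : hom B B') (g : hom A A') : i · f = g · j -> f · j⁻¹ = i⁻¹ · g.
Proof.
move=> e; apply: (@iso_cancel_l _ _ _ i).
by rewrite -comp_assoc e comp_assoc fwd_bwd comp_idr fwd_bwd_under.
Qed.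

Definition iso_inv (A B : C) (i : iso A B) : iso B A :=
  Iso (bwd_fwd i) (fwd_bwd i).

Definition iso_comp (A B D : C) (i : iso A B) (j : iso B D) : iso A D.
Proof.
refine (@Iso C A D (i · j) (j⁻¹ · i⁻¹) _ _).
- by rewrite comp_assoc fwd_bwd_under fwd_bwd.
- by rewrite comp_assoc bwd_fwd_under bwd_fwd.
Defined.

End Composition.

(** * Monoidal categories *)

Section Monoidal.
Variables (C : category) (M : monoidal C).
Local Notation "A ⊠ B" := (tens M A B) (at level 35).
Local Notation "f ⊠₁ g" := (tmap M f g) (at level 35).
Local Notation I := (unit M).
Local Notation a := (assoc M).

Lemma whisk_l (A B D E : C) (f : hom B D) (g : hom D E) :
  idm A ⊠₁ (f · g) = (1 ⊠₁ f) · (1 ⊠₁ g).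
Proof. by rewrite -tmap_comp comp_idl. Qed.

Lemma whisk_r (A B D E : C) (f : hom B D) (g : hom D E) :
  (f · g) ⊠₁ idm A = (f ⊠₁ 1) · (g ⊠₁ 1).
Proof. by rewrite -tmap_comp comp_idl. Qed.

Lemma interchange (A A' B B' : C) (f : hom A A') (g : hom B B') :
  (f ⊠₁ 1) · (1 ⊠₁ g) = (1 ⊠₁ g) · (f ⊠₁ 1).
Proof. by rewrite -!tmap_comp !comp_idl !comp_idr. Qed.

Lemma tmap_split (A A' B B' : C) (f : hom A A') (g : hom B B') :
  f ⊠₁ g = (f ⊠₁ 1) · (1 ⊠₁ g).
Proof. by rewrite -tmap_comp comp_idl comp_idr. Qed.

Definition tmap_iso (A A' B B' : C) (i : iso A A') (j : iso B B') :
  iso (A ⊠ B) (A' ⊠ B').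
Proof.
refine (@Iso C _ _ (i ⊠₁ j) (i⁻¹ ⊠₁ j⁻¹) _ _).
- by rewrite -tmap_comp !fwd_bwd tmap_id.
- by rewrite -tmap_comp !bwd_fwd tmap_id.
Defined.

Lemma tmap_inv_square (A A' B B' E : C) (i : iso A A') (j : iso B B')
    (k : iso (A ⊠ B) E) (f : hom (A' ⊠ B') E) :
  (i ⊠₁ j) · f = k -> f · k⁻¹ = i⁻¹ ⊠₁ j⁻¹.
Proof.
move=> e; apply: (@iso_cancel_l _ _ _ _ (tmap_iso i j)).
by rewrite fwd_bwd -comp_assoc e fwd_bwd.
Qed.

Definition id_iso (A : C) : iso A A := Iso (comp_idl 1) (comp_idl 1).

Lemma assoc_inv_nat (A A' B B' D D' : C)
    (f : hom A A') (g : hom B B') (h : hom D D') :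
  (f ⊠₁ (g ⊠₁ h)) · (a A' B' D')⁻¹ = (a A B D)⁻¹ · ((f ⊠₁ g) ⊠₁ h).
Proof.
by apply: iso_move_l; rewrite -comp_assoc -assoc_nat comp_assoc fwd_bwd comp_idr.
Qed.

Lemma assoc_nat_r (A B D D' : C) (h : hom D D') :
  (1 ⊠₁ h) · a A B D' = a A B D · (1 ⊠₁ (1 ⊠₁ h)).
Proof. by rewrite -assoc_nat tmap_id. Qed.

Lemma assoc_nat_l (A A' B D : C) (f : hom A A') :
  ((f ⊠₁ 1) ⊠₁ 1) · a A' B D = a A B D · (f ⊠₁ 1).
Proof. by rewrite assoc_nat tmap_id. Qed.

Lemma assoc_nat_m (A B B' D : C) (f : hom B B') :
  ((1 ⊠₁ f) ⊠₁ 1) · a A B' D = a A B D · (1 ⊠₁ (f ⊠₁ 1)).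
Proof. exact: assoc_nat. Qed.

Lemma assoc_inv_nat_l (A A' B D : C) (f : hom A A') :
  (f ⊠₁ 1) · (a A' B D)⁻¹ = (a A B D)⁻¹ · ((f ⊠₁ 1) ⊠₁ 1).
Proof. by rewrite -assoc_inv_nat tmap_id. Qed.

Lemma assoc_inv_nat_r (A B D D' : C) (h : hom D D') :
  (1 ⊠₁ (1 ⊠₁ h)) · (a A B D')⁻¹ = (a A B D)⁻¹ · (1 ⊠₁ h).
Proof. by rewrite assoc_inv_nat tmap_id. Qed.

Lemma lunit_inv_nat (A A' : C) (f : hom A A') :
  f · (lunit M A')⁻¹ = (lunit M A)⁻¹ · (1 ⊠₁ f).
Proof.
by apply: iso_move_l; rewrite -comp_assoc -lunit_nat comp_assoc fwd_bwd comp_idr.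
Qed.

Lemma unit_tens_faithful (A B : C) (f g : hom A B) :
  idm I ⊠₁ f = 1 ⊠₁ g -> f = g.
Proof.
move=> e; apply: (@iso_cancel_l _ _ _ _ (lunit M A)).
by rewrite -!lunit_nat e.
Qed.

(** Kelly's argument: whiskering with [I] is faithful, and after it the pentagon
    for [I, I, A, B] and two instances of the triangle give the equation. *)
Lemma lunit_tens (A B : C) : a I A B · lunit M (A ⊠ B) = lunit M A ⊠₁ 1.
Proof.
apply: unit_tens_faithful.
apply: (@iso_cancel_l _ _ _ _
  (iso_comp (tmap_iso (a I I A) (id_iso B)) (a I (I ⊠ A) B))).
rewrite /= whisk_l -comp_assoc -pentagon comp_assoc triangle.
rewrite -[X in _ · (_ ⊠₁ X)]tmap_id -assoc_nat.
by rewrite comp_assoc -assoc_nat -comp_assoc -tmap_comp triangle comp_idl.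
Qed.

End Monoidal.

Lemma bwd_unique (C : category) (A B : C) (i j : iso A B) :
  fwd i = fwd j -> i⁻¹ = j⁻¹.
Proof.
by move=> e; apply: (@iso_cancel_l _ _ _ _ i); rewrite fwd_bwd e fwd_bwd.
Qed.

Section Reversal.
Variable C : category.

(** Order reversal turns statements on the left into statements on the right;
    conversions below rely on its reducing by computation, so it and the other
    reversals are transparent. *)
Definition monoidal_rev (M : monoidal C) : monoidal C.
Proof.
refine (@Monoidal C (unit M) (fun A B => tens M B A)
  (fun A A' B B' f g => tmap M g f)
  (fun A B D => iso_inv (assoc M D B A)) (runit M) (lunit M) _ _ _ _ _ _ _).
- by move=> *; apply: tmap_id.
- by move=> *; apply: tmap_comp.
- by move=> *; apply: assoc_inv_nat.
- by move=> *; apply: runit_nat.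
- by move=> *; apply: lunit_nat.
- move=> A B D E /=.
  have := @bwd_unique _ _ _
    (iso_comp (assoc M (tens M E D) B A) (assoc M E D (tens M B A)))
    (iso_comp (iso_comp (tmap_iso M (assoc M E D B) (id_iso A))
                        (assoc M E (tens M D B) A))
              (tmap_iso M (id_iso E) (assoc M D B A))).
  by rewrite /= !comp_assoc => -> //; rewrite pentagon comp_assoc.
- by move=> A B /=; rewrite -triangle bwd_fwd_under.
Defined.

Lemma runit_tens (M : monoidal C) (A B : C) :
  assoc M A B (unit M) · tmap M 1 (runit M B) = runit M (tens M A B).
Proof.
symmetry; apply: (@iso_cancel_l _ _ _ _ (iso_inv (assoc M A B (unit M)))).
by rewrite /= bwd_fwd_under; apply: (lunit_tens (monoidal_rev M) B A).
Qed.

(** Both unitors, tensored on the right with [I], are the associator followed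
    by [1 ⊗ lunit]. *)
Lemma lunit_unit (M : monoidal C) : fwd (lunit M (unit M)) = runit M (unit M).
Proof.
apply: (@unit_tens_faithful _ (monoidal_rev M)) => /=.
rewrite -lunit_tens -triangle; congr (_ · _).
by apply: (@iso_cancel_r _ _ _ _ (lunit M (unit M))); rewrite lunit_nat.
Qed.

End Reversal.

Definition ldc_rev (X : ldc) : ldc.
Proof.
refine (@LDC (@Bimonoidal X (monoidal_rev (@tensor X)) (monoidal_rev (@par X)))
  (fun A B D => dR D B A) (fun A B D => dL D B A) _ _ _ _ _ _ _ _ _ _ _ _) => /=.
- by move=> *; apply: dR_nat.
- by move=> *; apply: dL_nat.
- by move=> *; apply: dR_uRT.
- by move=> *; apply: dL_uLT.
- by move=> *; apply: dR_uLP.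
- by move=> *; apply: dL_uRP.
- move=> A B D E.
  apply: (@iso_cancel_l _ _ _ _ (aT (E ⊕ D) B A)).
  rewrite -comp_assoc dR_aT !comp_assoc fwd_bwd_under -whisk_l.
  by rewrite fwd_bwd tmap_id comp_idr.
- move=> A B D E.
  apply: (@iso_cancel_l _ _ _ _ (aT E D (B ⊕ A))); rewrite fwd_bwd_under.
  rewrite -!comp_assoc -dL_aT !comp_assoc.
  by rewrite -whisk_r fwd_bwd tmap_id comp_idr.
- move=> A B D E.
  apply: (@iso_cancel_r _ _ _ _ (aP E D (B ⊗ A))).
  rewrite !comp_assoc bwd_fwd comp_idr dR_aP -!comp_assoc -whisk_r.
  by rewrite bwd_fwd tmap_id comp_idl.
- move=> A B D E.
  apply: (@iso_cancel_r _ _ _ _ (aP (E ⊗ D) B A)).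
  rewrite !comp_assoc bwd_fwd comp_idr -[X in _ · X]comp_assoc -dL_aP.
  rewrite -!comp_assoc -whisk_l.
  by rewrite bwd_fwd tmap_id comp_idl.
- move=> A B D E.
  apply: (@iso_cancel_l _ _ _ _ (aT E (D ⊕ B) A)).
  by rewrite -!comp_assoc -dL_dR_aT fwd_bwd comp_idl.
- move=> A B D E.
  apply: (@iso_cancel_r _ _ _ _ (aP E (D ⊗ B) A)).
  by rewrite !comp_assoc bwd_fwd comp_idr -comp_assoc dL_dR_aP.
Defined.

(** * The adjunction given by a linear dual *)

Section Adjunction.
Variable X : ldc.
Implicit Types A B P Q W Z : X.

(** Counit and unit of the adjunction [A ⊗ -] ⊣ [P ⊕ -]. They are locked so
    that matching modulo associativity does not look inside them; [evE] and
    [coevE] open them. *)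
Definition ev P A (d : dual_pair P A) W : hom (A ⊗ (P ⊕ W)) W :=
  locked (dL A P W · (eps d ⊕₁ 1) · uLP W).

Definition coev P A (d : dual_pair P A) Z : hom Z (P ⊕ (A ⊗ Z)) :=
  locked ((uLT Z)⁻¹ · (eta d ⊗₁ 1) · dR P A Z).

Lemma evE P A (d : dual_pair P A) W :
  ev d W = dL A P W · (eps d ⊕₁ 1) · uLP W.
Proof. by rewrite /ev -lock. Qed.

Lemma coevE P A (d : dual_pair P A) Z :
  coev d Z = (uLT Z)⁻¹ · (eta d ⊗₁ 1) · dR P A Z.
Proof. by rewrite /coev -lock. Qed.

Lemma dL_nat_l A A' B W (f : hom A A') :
  (f ⊗₁ 1) · dL A' B W = dL A B W · ((f ⊗₁ 1) ⊕₁ 1).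
Proof. by rewrite -dL_nat tmap_id. Qed.

Lemma dL_nat_m A B B' W (f : hom B B') :
  (1 ⊗₁ (f ⊕₁ 1)) · dL A B' W = dL A B W · ((1 ⊗₁ f) ⊕₁ 1).
Proof. exact: dL_nat. Qed.

Lemma dL_nat_r A B W W' (f : hom W W') :
  (1 ⊗₁ (1 ⊕₁ f)) · dL A B W' = dL A B W · (1 ⊕₁ f).
Proof. by rewrite dL_nat tmap_id. Qed.

Lemma dR_nat_l A A' B W (f : hom A A') :
  ((f ⊕₁ 1) ⊗₁ 1) · dR A' B W = dR A B W · (f ⊕₁ 1).
Proof. by rewrite dR_nat tmap_id. Qed.

Lemma dR_nat_m A B B' W (f : hom B B') :
  ((1 ⊕₁ f) ⊗₁ 1) · dR A B' W = dR A B W · (1 ⊕₁ (f ⊗₁ 1)).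
Proof. exact: dR_nat. Qed.

Lemma dR_nat_r A B W W' (f : hom W W') :
  (1 ⊗₁ f) · dR A B W' = dR A B W · (1 ⊕₁ (1 ⊗₁ f)).
Proof. by rewrite -dR_nat tmap_id. Qed.

Lemma ev_nat P A (d : dual_pair P A) W W' (w : hom W W') :
  (1 ⊗₁ (1 ⊕₁ w)) · ev d W' = ev d W · w.
Proof.
rewrite !evE -!comp_assoc dL_nat_r !comp_assoc; congr (_ · _).
by rewrite -lunit_nat -!comp_assoc interchange.
Qed.

Lemma coev_nat P A (d : dual_pair P A) Z Z' (z : hom Z Z') :
  z · coev d Z' = coev d Z · (1 ⊕₁ (1 ⊗₁ z)).
Proof.
rewrite !coevE -!comp_assoc lunit_inv_nat !comp_assoc; congr (_ · _).
by rewrite -dR_nat_r -!comp_assoc interchange.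
Qed.

(** The coherence of [dL] with [dR] brings [eta] next to [eps], so that the
    triangle identity of the adjunction is the snake identity of [A] tensored
    with [Z]. *)
Lemma coev_ev P A (d : linear_dual P A) Z :
  (1 ⊗₁ coev d Z) · ev d (A ⊗ Z) = 1.
Proof.
have snake := f_equal (fun f => f ⊗₁ idm Z) (dual_right d).
rewrite /= tmap_id !whisk_r in snake; rewrite -[RHS]snake.
rewrite !coevE evE !whisk_l !comp_assoc.
rewrite -dR_uLP (comp_under (dR_nat_l _ _ _)) !comp_assoc.
rewrite (comp_under (dL_dR_aT _ _ _ _)) !comp_assoc.
rewrite (comp_under (assoc_nat_m _ _ _ _)) !comp_assoc.
rewrite -!comp_assoc; do 5!congr (_ · _).
apply: (@iso_cancel_l _ _ _ _ (tmap_iso tensor (runit tensor A) (id_iso Z))).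
rewrite /= -!comp_assoc -!whisk_r fwd_bwd tmap_id comp_idl.
by rewrite -triangle comp_assoc -whisk_l fwd_bwd tmap_id comp_idr.
Qed.

(** Likewise from the snake identity of [P], by the coherence of [dL] and [dR]
    with the associator of par. *)
Lemma coev_ev_par P A (d : linear_dual P A) W :
  coev d (P ⊕ W) · (1 ⊕₁ ev d W) = 1.
Proof.
have snake := f_equal (fun f => f ⊕₁ idm W) (dual_left d).
rewrite /= tmap_id !whisk_r in snake; rewrite -[RHS]snake.
rewrite !coevE evE !whisk_l !comp_assoc.
rewrite (comp_under (esym (dL_dR_aP _ _ _ _))) !comp_assoc.
rewrite (comp_under (esym (assoc_nat_m _ _ _ _))) !comp_assoc triangle.
rewrite (comp_under (dL_nat_l _ _ _)) !comp_assoc.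
rewrite -!comp_assoc; do 4!congr (_ · _).
apply: (@iso_cancel_l _ _ _ _ (lunit tensor (P ⊕ W))); rewrite fwd_bwd_under.
by rewrite -dL_uLT comp_assoc -whisk_r fwd_bwd tmap_id comp_idr.
Qed.

Lemma ev_eta P A (d : linear_dual P A) : (1 ⊗₁ eta d) · ev d A = uRT A.
Proof.
apply: (@iso_cancel_l _ _ _ _ (iso_inv (runit tensor A))).
by rewrite /= bwd_fwd evE -!comp_assoc; apply: dual_right.
Qed.

Lemma coev_eps P A (d : linear_dual P A) : coev d P · (1 ⊕₁ eps d) · uRP P = 1.
Proof. rewrite !coevE; exact: dual_left. Qed.

Lemma ev_bot P A (d : dual_pair P A) : (1 ⊗₁ uRP P) · eps d = ev d ⊥.
Proof. by rewrite !evE lunit_unit comp_assoc runit_nat -dL_uRP comp_assoc. Qed.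

(** Transposition along the adjunction for the target [⊥], in the form
    [hom (A ⊗ Z) ⊥ ≅ hom Z P]; [eps_inj] is the other half. *)
Lemma eps_curry P A (d : linear_dual P A) Z (h : hom (A ⊗ Z) ⊥) :
  (1 ⊗₁ (coev d Z · (1 ⊕₁ h) · uRP P)) · eps d = h.
Proof.
rewrite 2!whisk_l !comp_assoc ev_bot ev_nat -comp_assoc.
by rewrite coev_ev comp_idl.
Qed.

Lemma eps_inj P A (d : linear_dual P A) Z (m n : hom Z P) :
  (1 ⊗₁ m) · eps d = (1 ⊗₁ n) · eps d -> m = n.
Proof.
have h k : k = coev d Z · (1 ⊕₁ ((1 ⊗₁ k) · eps d)) · uRP P.
  rewrite whisk_l -!comp_assoc -coev_nat -[LHS]comp_idr -{1}(coev_eps d).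
  by rewrite -!comp_assoc.
by move=> e; rewrite (h m) e -h.
Qed.

End Adjunction.

(** * Mates *)

Section Mates.
Variable X : ldc.
Implicit Types A B P Q : X.

(** [m] is the transpose of [f] along the duals. A predicate on pairs, in place
    of the operation [left_mate], lets identities be proved by giving two
    derivations for the same [f], and it is symmetric under [ldc_rev]. *)
Definition mates P A P' A' (d : dual_pair P A) (d' : dual_pair P' A')
    (f : hom A A') (m : hom P' P) : Prop :=
  (1 ⊗₁ m) · eps d = (f ⊗₁ 1) · eps d'.

Lemma mates_unique P A P' A' (d : linear_dual P A) (d' : dual_pair P' A')
    (f : hom A A') (m n : hom P' P) :
  mates d d' f m -> mates d d' f n -> m = n.
Proof. by rewrite /mates => hm hn; apply: (@eps_inj _ _ _ d); rewrite hm hn. Qed.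

Lemma mates_id P A (d : dual_pair P A) : mates d d 1 1.
Proof. by []. Qed.

Lemma mates_comp P A P' A' P'' A'' (d : dual_pair P A) (d' : dual_pair P' A')
    (d'' : dual_pair P'' A'') f g m n :
  mates d d' f m -> mates d' d'' g n -> mates d d'' (f · g) (n · m).
Proof.
rewrite /mates => hm hn; rewrite whisk_l whisk_r !comp_assoc hm -hn.
by rewrite -!comp_assoc interchange.
Qed.

(** In derivations [f] is often a composite with identities, to be replaced by
    its simplified form. *)
Lemma mates_comp_eq P A P' A' P'' A''
    (d : dual_pair P A) (d' : dual_pair P' A') (d'' : dual_pair P'' A'')
    f g h m n :
  mates d d' f m -> mates d' d'' g n -> f · g = h -> mates d d'' h (n · m).
Proof. by move=> hm hn <-; apply: mates_comp hm hn. Qed.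

Lemma mates_inv P A P' A' (d : dual_pair P A) (d' : dual_pair P' A')
    (f : iso A A') (m : iso P' P) :
  mates d d' f m -> mates d' d f⁻¹ m⁻¹.
Proof.
rewrite /mates => h.
apply: (@iso_cancel_l _ _ _ _ (tmap_iso tensor f m)); rewrite /=.
by rewrite -!comp_assoc -!tmap_comp !fwd_bwd !comp_idr h.
Qed.

Lemma mates_left_mate P A P' A' (d : linear_dual P A) (d' : dual_pair P' A')
    (f : hom A A') : mates d d' f (left_mate d d' f).
Proof.
rewrite /mates -[RHS](eps_curry d); congr ((1 ⊗₁ _) · _).
rewrite /left_mate coevE whisk_l !comp_assoc.
by rewrite (comp_under (dR_nat_m _ _ _)) !comp_assoc.
Qed.

Lemma mates_left_dual_iso P P' A (d : linear_dual P A) (d' : dual_pair P' A) :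
  mates d d' 1 (left_dual_iso d' d).
Proof.
have := mates_left_mate d d' 1; congr mates.
by rewrite /left_mate /left_dual_iso !tmap_id comp_idr.
Qed.

(** The defining equation of mates, read on the units. The dagger exchanges
    [eta] and [eps], so this form is what lets it act on mates. *)
Lemma mates_eta P A P' A' (d : linear_dual P A) (d' : linear_dual P' A')
    (f : hom A A') (m : hom P' P) :
  mates d d' f m -> eta d · (1 ⊕₁ f) = eta d' · (m ⊕₁ 1).
Proof.
rewrite /mates => h.
have inj u v : (1 ⊗₁ u) · ev d A' = (1 ⊗₁ v) · ev d A' -> u = v :> hom ⊤ _.
  (* Transposing along the adjunction of [d] is injective. *)
  move=> e; rewrite -[u]comp_idr -[v]comp_idr -(coev_ev_par d A').
  by rewrite -!comp_assoc !coev_nat !comp_assoc -!whisk_l e.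
apply: inj; rewrite !whisk_l !comp_assoc ev_nat -comp_assoc ev_eta.
rewrite -runit_nat -(ev_eta d') -!comp_assoc interchange !comp_assoc; congr (_ · _).
rewrite !evE -!comp_assoc dL_nat_m dL_nat_l !comp_assoc; congr (_ · _).
by rewrite -!comp_assoc -!whisk_r h.
Qed.

Lemma left_dual_iso_inv P P' A (d : linear_dual P A) (d' : linear_dual P' A) :
  left_dual_iso d d' · left_dual_iso d' d = 1.
Proof.
apply: (@mates_unique _ _ _ _ d d 1); last exact: mates_id.
rewrite -[X in mates _ _ X _]comp_idl.
apply: mates_comp; exact: mates_left_dual_iso.
Qed.

Definition left_dual_iso_iso P P' A (d : linear_dual P A) (d' : linear_dual P' A)
  : iso P P' := Iso (left_dual_iso_inv d d') (left_dual_iso_inv d' d).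

Lemma mates_canonical A P P' (d : linear_dual P A) (d' : linear_dual P' A) :
  mates d' d 1 (left_dual_iso_iso d d').
Proof. exact: mates_left_dual_iso. Qed.

Lemma mates_canonical_inv A P P' (d : linear_dual P A) (d' : linear_dual P' A) :
  mates d d' 1 (left_dual_iso_iso d d')⁻¹.
Proof. exact: mates_left_dual_iso. Qed.

End Mates.

Section ReversedPairs.
Variable X : ldc.

Definition pair_rev (P A : X) (d : dual_pair P A) : @dual_pair (ldc_rev X) A P :=
  @DualPair (ldc_rev X) A P (eta d) (eps d).

Definition dual_rev (P A : X) (d : linear_dual P A) :
  @linear_dual (ldc_rev X) A P :=
  @LinearDual (ldc_rev X) A P (pair_rev d) (dual_right d) (dual_left d).

Lemma mates_rev (P A P' A' : X) (d : dual_pair P A) (d' : dual_pair P' A')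
    (f : hom A A') (m : hom P' P) :
  mates d d' f m -> mates (pair_rev d') (pair_rev d) m f.
Proof. exact: esym. Qed.

Lemma mates_unrev (P A P' A' : X) (d : dual_pair P A) (d' : dual_pair P' A')
    (f : hom A A') (m : hom P' P) :
  mates (pair_rev d') (pair_rev d) m f -> mates d d' f m.
Proof. exact: esym. Qed.

End ReversedPairs.

(** * Duals of tensor products and of pars *)

Section TensorDuals.
Variable X : ldc.
Implicit Types A B C P Q R W Z : X.

Lemma tens_etaE P A Q B (d : dual_pair P A) (e : dual_pair Q B) :
  eta (tens_pair d e) = eta e · (1 ⊕₁ coev d B) · (aP Q P (A ⊗ B))⁻¹.
Proof. by rewrite coevE. Qed.

Lemma tens_epsE P A Q B (d : dual_pair P A) (e : dual_pair Q B) :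
  eps (tens_pair d e) = aT A B (Q ⊕ P) · (1 ⊗₁ ev e P) · eps d.
Proof. by rewrite evE. Qed.

Lemma ev_assoc Q B (e : dual_pair Q B) P W :
  (1 ⊗₁ aP Q P W) · ev e (P ⊕ W) = dL B (Q ⊕ P) W · (ev e P ⊕₁ 1).
Proof.
rewrite !evE !whisk_r -!comp_assoc dL_aP !comp_assoc; congr (_ · (_ · _)).
by rewrite -lunit_tens -!comp_assoc assoc_nat_l.
Qed.

Lemma coev_assoc P A (d : dual_pair P A) B Z :
  (coev d B ⊗₁ 1) · dR P (A ⊗ B) Z = coev d (B ⊗ Z) · (1 ⊕₁ (aT A B Z)⁻¹).
Proof.
apply: (@iso_cancel_r _ _ _ _ (tmap_iso par (id_iso P) (aT A B Z))) => /=.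
rewrite [RHS]comp_assoc -whisk_l bwd_fwd tmap_id comp_idr.
rewrite !coevE !whisk_r !comp_assoc.
have -> : (dR P A B ⊗₁ 1) · (dR P (A ⊗ B) Z · (1 ⊕₁ aT A B Z))
  = aT (P ⊕ A) B Z · dR P A (B ⊗ Z) by rewrite dR_aT comp_assoc.
rewrite (comp_under (assoc_nat_l _ _ _ _)) comp_assoc.
rewrite -!comp_assoc; do 2!congr (_ · _).
apply: (@iso_cancel_l _ _ _ _ (tmap_iso tensor (lunit tensor B) (id_iso Z))) => /=.
rewrite -comp_assoc -whisk_r fwd_bwd tmap_id comp_idl.
by rewrite -lunit_tens comp_assoc fwd_bwd comp_idr.
Qed.

(** The counit of [tens_pair d e] is that of the composite adjunction
    [A ⊗ (B ⊗ -)] ⊣ [Q ⊕ (P ⊕ -)], up to associators. *)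
Lemma ev_tens_pair P A Q B (d : dual_pair P A) (e : dual_pair Q B) W :
  ev (tens_pair d e) W
  = (1 ⊗₁ aP Q P W) · aT A B (Q ⊕ (P ⊕ W)) · (1 ⊗₁ ev e (P ⊕ W)) · ev d W.
Proof.
rewrite assoc_nat_r !comp_assoc (comp_under (esym (whisk_l _ _ _ _))) ev_assoc.
rewrite (evE (tens_pair d e)) tens_epsE !whisk_r !comp_assoc.
rewrite (comp_under (dL_aT _ _ _ _)) !comp_assoc; congr (_ · _).
rewrite whisk_l !comp_assoc; congr (_ · _).
by rewrite (evE d) -!comp_assoc dL_nat_m.
Qed.

Lemma coev_tens_pair P A Q B (d : dual_pair P A) (e : dual_pair Q B) Z :
  coev (tens_pair d e) Z
  = coev e Z · (1 ⊕₁ coev d (B ⊗ Z)) · (aP Q P (A ⊗ (B ⊗ Z)))⁻¹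
    · (1 ⊕₁ (aT A B Z)⁻¹).
Proof.
rewrite !comp_assoc -assoc_inv_nat_r (comp_under (esym (whisk_l _ _ _ _))).
rewrite -coev_assoc (coevE (tens_pair d e)) tens_etaE !whisk_r !comp_assoc.
have -> : ((aP Q P (A ⊗ B))⁻¹ ⊗₁ 1) · dR (Q ⊕ P) (A ⊗ B) Z
  = dR Q (P ⊕ (A ⊗ B)) Z · (1 ⊕₁ dR P (A ⊗ B) Z) · (aP Q P ((A ⊗ B) ⊗ Z))⁻¹.
  apply: iso_move_r; rewrite comp_assoc dR_aP -!comp_assoc -whisk_r.
  by rewrite bwd_fwd tmap_id comp_idl.
rewrite !comp_assoc (comp_under (dR_nat_m _ _ _)) whisk_l (coevE e).
by rewrite !comp_assoc.
Qed.

(** This and [tens_pair_right] are snake identities: with the unit and counit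
    written as composites, that of [d] cancels inside that of [e]. *)
Lemma tens_pair_left P A Q B (d : linear_dual P A) (e : linear_dual Q B) :
  coev (tens_pair d e) (Q ⊕ P) · (1 ⊕₁ eps (tens_pair d e)) · uRP (Q ⊕ P) = 1.
Proof.
rewrite coev_tens_pair tens_epsE !comp_assoc (comp_under (esym (whisk_l _ _ _ _))).
rewrite bwd_fwd_under whisk_l !comp_assoc -runit_tens.
do 2!rewrite (comp_under (esym (assoc_inv_nat_r _ _ _ _))) ?comp_assoc.
rewrite bwd_fwd_under -!whisk_l -!comp_assoc -coev_nat.
rewrite !comp_assoc -(comp_assoc (coev d _)) coev_eps comp_idr.
exact: coev_ev_par.
Qed.

Lemma tens_pair_right P A Q B (d : linear_dual P A) (e : linear_dual Q B) :
  (1 ⊗₁ eta (tens_pair d e)) · ev (tens_pair d e) (A ⊗ B) = uRT (A ⊗ B).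
Proof.
rewrite ev_tens_pair tens_etaE !comp_assoc (comp_under (esym (whisk_l _ _ _ _))).
rewrite !comp_assoc bwd_fwd comp_idr.
rewrite (comp_under (assoc_nat_r _ _ _ _)) !comp_assoc.
rewrite (comp_under (esym (whisk_l _ _ _ _))) (whisk_l _ _ (eta e)) comp_assoc.
rewrite ev_nat -(comp_assoc (1 ⊗₁ eta e)) ev_eta whisk_l !comp_assoc coev_ev comp_idr.
exact: runit_tens.
Qed.

Definition tens_dual P A Q B (d : linear_dual P A) (e : linear_dual Q B) :
  linear_dual (Q ⊕ P) (A ⊗ B).
Proof.
refine (@LinearDual X _ _ (tens_pair d e) _ _).
- by rewrite -coevE; apply: tens_pair_left.
- have := tens_pair_right d e; rewrite evE !comp_assoc => ->.
  exact: bwd_fwd.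
Defined.

Lemma ev_mates Q B Q' B' (e : dual_pair Q B) (e' : dual_pair Q' B') g n W :
  mates e e' g n -> (1 ⊗₁ (n ⊕₁ 1)) · ev e W = (g ⊗₁ 1) · ev e' W.
Proof.
rewrite /mates => h; rewrite !evE -!comp_assoc dL_nat_m dL_nat_l.
by rewrite !comp_assoc !(comp_under (esym (whisk_r _ _ _ _))) h.
Qed.

Lemma mates_tens P A Q B P' A' Q' B'
    (d : dual_pair P A) (e : dual_pair Q B)
    (d' : dual_pair P' A') (e' : dual_pair Q' B') f g m n :
  mates d d' f m -> mates e e' g n ->
  mates (tens_pair d e) (tens_pair d' e') (f ⊗₁ g) (n ⊕₁ m).
Proof.
move=> hm hn; rewrite /mates !tens_epsE !comp_assoc.
have ev_n : (1 ⊗₁ (n ⊕₁ m)) · ev e P = (g ⊗₁ 1) · ev e' P' · m.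
  by rewrite (tmap_split par n) whisk_l comp_assoc ev_nat -comp_assoc (ev_mates _ hn).
rewrite (comp_under (assoc_nat_r _ _ _ _)) (comp_under (assoc_nat _ _ _ _)).
rewrite !comp_assoc; congr (_ · _).
rewrite (comp_under (esym (whisk_l _ _ _ _))).
rewrite ev_n !whisk_l !comp_assoc hm.
rewrite (comp_under (esym (interchange _ _ _))) comp_assoc.
by rewrite (comp_under (esym (interchange _ _ _))) -tmap_split.
Qed.

Lemma mates_assoc P A Q B R C
    (d : dual_pair P A) (e : dual_pair Q B) (k : dual_pair R C) :
  mates (tens_pair (tens_pair d e) k) (tens_pair d (tens_pair e k))
    (aT A B C) (aP R Q P).
Proof.
rewrite /mates (tens_epsE (tens_pair d e)) (tens_epsE d e).
rewrite (tens_epsE d (tens_pair e k)) ev_tens_pair !whisk_l !comp_assoc.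
rewrite (comp_under (esym (assoc_nat_r _ _ _ _))) !comp_assoc.
rewrite (comp_under (interchange _ _ _)) !comp_assoc; congr (_ · _).
rewrite (comp_under (assoc_nat_r _ _ _ _)) !comp_assoc.
by rewrite (comp_under (pentagon _ _ _ _ _)) !comp_assoc.
Qed.

(** Both pairings first remove [C], through [ve]: from [B ⊕ C] under [A], or from
    [(A ⊗ B) ⊕ C]. So it is enough to move [ve] past the two distributors, as
    [dL_ve] and [ev_ve] do. *)
Lemma mates_dL P A Q B R C
    (d : dual_pair P A) (e : dual_pair Q B) (k : dual_pair R C) :
  mates (tens_pair d (par_pair e k)) (par_pair (tens_pair d e) k)
    (dL A B C) (dL R Q P).
Proof.
pose ve W := dR W C R · (1 ⊕₁ eps k) · uRP W.
have par_epsE S U (b : dual_pair S U) :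
    eps (par_pair b k) = (aT _ _ _)⁻¹ · (ve U ⊗₁ 1) · eps b by [].
have dL_ve : (dL A B C ⊗₁ 1) · ve (A ⊗ B) = aT A (B ⊕ C) R · (1 ⊗₁ ve B).
  rewrite /ve -!comp_assoc dL_dR_aT 2!whisk_l -dL_uRP !comp_assoc.
  by rewrite (comp_under (dL_nat_r _ _ _)) !comp_assoc.
rewrite /mates tens_epsE !par_epsE tens_epsE.
have ev_ve : (1 ⊗₁ dL R Q P) · ev (par_pair e k) P
   = (aT (B ⊕ C) R (Q ⊕ P))⁻¹ · (ve B ⊗₁ 1) · ev e P.
  apply: (@iso_cancel_l _ _ _ _ (aT (B ⊕ C) R (Q ⊕ P))).
  rewrite (evE (par_pair e k)) par_epsE !comp_assoc fwd_bwd_under 2!whisk_r !comp_assoc.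
  rewrite -[LHS]comp_assoc -[LHS]comp_assoc -dL_aT !comp_assoc.
  rewrite (comp_under (esym (whisk_r _ _ _ _))) fwd_bwd tmap_id comp_idl.
  by rewrite (comp_under (esym (dL_nat_l _ _ _))) evE !comp_assoc.
rewrite !comp_assoc (comp_under (assoc_nat_r _ _ _ _)) !comp_assoc.
rewrite (comp_under (esym (whisk_l _ _ _ _))) ev_ve.
rewrite (comp_under (assoc_inv_nat_l _ _ _ _)) !comp_assoc.
rewrite (comp_under (esym (whisk_r _ _ _ _))) dL_ve.
apply: (@iso_cancel_l _ _ _ _ (aT (A ⊗ (B ⊕ C)) R (Q ⊕ P))).
rewrite fwd_bwd_under (comp_under (pentagon _ _ _ _ _)) !comp_assoc.
rewrite (comp_under (esym (whisk_l _ _ _ _))) fwd_bwd_under.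
rewrite whisk_r !comp_assoc (comp_under (assoc_nat_m _ _ _ _)) !comp_assoc.
by rewrite whisk_l !comp_assoc.
Qed.

End TensorDuals.

Section ParDuals.
Variable X : ldc.
Implicit Types A B C P Q R : X.

(** The pair [par_pair d e] is convertible to [tens_pair] of the reversed duals
    in [ldc_rev X], so the results for tensor transfer as they stand. *)
Definition par_dual P A Q B (d : linear_dual P A) (e : linear_dual Q B) :
  linear_dual (Q ⊗ P) (A ⊕ B) :=
  let r := tens_dual (dual_rev d) (dual_rev e) in
  @LinearDual X _ _ (par_pair d e) (dual_right r) (dual_left r).

Lemma mates_par P A Q B P' A' Q' B'
    (d : dual_pair P A) (e : dual_pair Q B)
    (d' : dual_pair P' A') (e' : dual_pair Q' B') f g m n :
  mates d d' f m -> mates e e' g n ->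
  mates (par_pair d e) (par_pair d' e') (f ⊕₁ g) (n ⊗₁ m).
Proof.
move=> hm hn; apply: mates_unrev.
exact: (mates_tens (mates_rev hm) (mates_rev hn)).
Qed.

Lemma mates_par_assoc P A Q B R C
    (d : dual_pair P A) (e : dual_pair Q B) (k : dual_pair R C) :
  mates (par_pair d (par_pair e k)) (par_pair (par_pair d e) k)
    (aP A B C)⁻¹ (aT R Q P)⁻¹.
Proof.
apply: mates_unrev.
exact: (mates_assoc (pair_rev d) (pair_rev e) (pair_rev k)).
Qed.

Lemma mates_dR P A Q B R C
    (d : dual_pair P A) (e : dual_pair Q B) (k : dual_pair R C) :
  mates (tens_pair (par_pair d e) k) (par_pair d (tens_pair e k))
    (dR A B C) (dR R Q P).
Proof.
apply: mates_unrev.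
exact: (mates_dL (pair_rev d) (pair_rev e) (pair_rev k)).
Qed.

End ParDuals.

(** * Duals and the dagger *)

Definition dag_iso (X : ldc) (D : dagger X) (A B : X) (i : iso A B) :
  iso (dag D B) (dag D A).
Proof.
refine (@Iso X _ _ (dag_map D i) (dag_map D i⁻¹) _ _).
- by rewrite -dag_comp bwd_fwd dag_id.
- by rewrite -dag_comp fwd_bwd dag_id.
Defined.

Definition dagger_rev (X : ldc) (D : dagger X) : dagger (ldc_rev X).
Proof.
refine (@Dagger (ldc_rev X) (dag D) (dag_map D) _ _
  (fun A B => lamT D B A) (fun A B => lamP D B A)
  (lam_top D) (lam_bot D) (iota D) _ _ _ _ _ _ _ _ _ _ _ _ _ _ _ _) => /=.
- exact: dag_id.
- exact: dag_comp.
- by move=> *; apply: lamT_nat.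
- by move=> *; apply: lamP_nat.
- by move=> *; apply: iota_nat.
- move=> A B C.
  apply: (@iso_cancel_r _ _ _ _ (dag_iso D (aP C B A))).
  rewrite /= !comp_assoc -dag_comp fwd_bwd dag_id comp_idr.
  by rewrite -[X in _ = _ · X]comp_assoc lamT_assoc !comp_assoc fwd_bwd_under.
- move=> A B C.
  apply: (@iso_cancel_r _ _ _ _ (dag_iso D (aT C B A))).
  rewrite /= !comp_assoc -dag_comp fwd_bwd dag_id comp_idr.
  by rewrite -[X in _ = _ · X]comp_assoc lamP_assoc !comp_assoc fwd_bwd_under.
- exact: lamT_runit.
- exact: lamT_lunit.
- exact: lamP_runit.
- exact: lamP_lunit.
- by move=> *; apply: lam_dR.
- by move=> *; apply: lam_dL.
- by move=> *; apply: iota_lamT.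
- by move=> *; apply: iota_lamP.
- exact: iota_bot.
- exact: iota_top.
- exact: iota_dag.
Defined.

Section Dagger.
Variables (X : ldc) (D : dagger X).
Implicit Types A B C P Q : X.
Local Notation "A †" := (dag D A) (at level 1, format "A †").
Local Notation "f ^†" := (dag_map D f) (at level 1, format "f ^†").

Lemma lamT_nat_l A A' B (f : hom A A') :
  (f^† ⊗₁ 1) · lamT D A B = lamT D A' B · (f ⊕₁ 1)^†.
Proof. by rewrite -lamT_nat dag_id. Qed.

Lemma lamT_nat_r A B B' (g : hom B B') :
  (1 ⊗₁ g^†) · lamT D A B = lamT D A B' · (1 ⊕₁ g)^†.
Proof. by rewrite -lamT_nat dag_id. Qed.

Lemma lamP_nat_l A A' B (f : hom A A') :
  (f^† ⊕₁ 1) · lamP D A B = lamP D A' B · (f ⊗₁ 1)^†.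
Proof. by rewrite -lamP_nat dag_id. Qed.

Lemma lamP_nat_r A B B' (g : hom B B') :
  (1 ⊕₁ g^†) · lamP D A B = lamP D A B' · (1 ⊗₁ g)^†.
Proof. by rewrite -lamP_nat dag_id. Qed.

Lemma lamP_inv_nat_l A A' B (f : hom A A') :
  (lamP D A' B)⁻¹ · (f^† ⊕₁ 1) = (f ⊗₁ 1)^† · (lamP D A B)⁻¹.
Proof. by apply: iso_move_r; rewrite comp_assoc lamP_nat_l bwd_fwd_under. Qed.

Lemma lamP_inv_nat_r A B B' (g : hom B B') :
  (lamP D A B')⁻¹ · (1 ⊕₁ g^†) = (1 ⊗₁ g)^† · (lamP D A B)⁻¹.
Proof. by apply: iso_move_r; rewrite comp_assoc lamP_nat_r bwd_fwd_under. Qed.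

Lemma lamT_assoc_inv A B C :
  aT A† B† C† · (1 ⊗₁ lamT D B C) · lamT D A (B ⊕ C)
  = (lamT D A B ⊗₁ 1) · lamT D (A ⊕ B) C · (aP A B C)⁻¹^†.
Proof.
apply: (@iso_cancel_r _ _ _ _ (dag_iso D (aP A B C))) => /=.
rewrite !comp_assoc -dag_comp fwd_bwd dag_id comp_idr.
by rewrite -[X in _ · X]comp_assoc lamT_assoc !comp_assoc fwd_bwd_under.
Qed.

Lemma lamP_assoc_inv A B C :
  aP A† B† C† · (1 ⊕₁ lamP D B C) · lamP D A (B ⊗ C)
  = (lamP D A B ⊕₁ 1) · lamP D (A ⊗ B) C · (aT A B C)⁻¹^†.
Proof.
apply: (@iso_cancel_r _ _ _ _ (dag_iso D (aT A B C))) => /=.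
rewrite !comp_assoc -dag_comp fwd_bwd dag_id comp_idr.
by rewrite -[X in _ · X]comp_assoc lamP_assoc !comp_assoc fwd_bwd_under.
Qed.

Lemma dag_dL A B C :
  ((lamP D C B)⁻¹ ⊗₁ 1) · dR C† B† A† · (1 ⊕₁ lamT D B A)
  = lamT D (C ⊗ B) A · (dL C B A)^† · (lamP D C (B ⊕ A))⁻¹.
Proof.
apply: iso_move_r.
rewrite !comp_assoc -[X in _ · X]comp_assoc lam_dR -!comp_assoc -whisk_r.
by rewrite bwd_fwd tmap_id comp_idl.
Qed.

Lemma dag_dR A B C :
  (1 ⊗₁ (lamP D B C)⁻¹) · dL A† B† C† · (lamT D A B ⊕₁ 1)
  = lamT D A (B ⊗ C) · (dR A B C)^† · (lamP D (A ⊕ B) C)⁻¹.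
Proof.
apply: iso_move_r.
rewrite !comp_assoc -[X in _ · X]comp_assoc lam_dL -!comp_assoc -whisk_l.
by rewrite bwd_fwd tmap_id comp_idl.
Qed.

Lemma dag_epsE P A (d : dual_pair P A) :
  eps (dag_pair D d) = lamT D P A · (eta d)^† · (lam_bot D)⁻¹.
Proof. by []. Qed.

(** The dagger turns the unit of the adjunction of [d] into the counit of the
    adjunction of [dag_pair D d]. *)
Lemma dag_ev P A (d : dual_pair P A) B :
  ev (dag_pair D d) B†
  = (1 ⊗₁ lamP D A B) · lamT D P (A ⊗ B) · (coev d B)^†.
Proof.
have lamP_unit : (lam_bot D ⊕₁ 1) · lamP D ⊤ B · (uLT B)⁻¹^† = uLP B†.
  by rewrite lamP_lunit comp_assoc -dag_comp bwd_fwd dag_id comp_idr.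
rewrite evE coevE !dag_comp -!comp_assoc -lam_dL !comp_assoc.
rewrite (comp_under (esym (lamP_nat _ _ _))) dag_id !comp_assoc.
have -> : lamP D ⊤ B · (uLT B)⁻¹^† = ((lam_bot D)⁻¹ ⊕₁ 1) · uLP B†.
  rewrite -lamP_unit !comp_assoc (comp_under (esym (whisk_r _ _ _ _))).
  by rewrite bwd_fwd tmap_id comp_idl.
by rewrite /= !whisk_r !comp_assoc.
Qed.

Lemma dag_snake P A (d : linear_dual P A) :
  (1 ⊗₁ eta (dag_pair D d)) · ev (dag_pair D d) P† = uRT P†.
Proof.
rewrite dag_ev /= !comp_assoc (comp_under (esym (whisk_l _ _ _ _))).
rewrite !comp_assoc bwd_fwd comp_idr whisk_l !comp_assoc.
rewrite (comp_under (lamT_nat_r _ _)) !comp_assoc -dag_comp.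
rewrite (comp_under (lamT_runit _ _)) comp_assoc -dag_comp.
by rewrite coev_eps dag_id comp_idr.
Qed.

Lemma eps_dag_tens P A Q B (d : dual_pair P A) (e : dual_pair Q B) :
  eps (tens_pair (dag_pair D e) (dag_pair D d))
  = (lamT D Q P ⊗₁ lamP D A B) · eps (dag_pair D (tens_pair d e)).
Proof.
rewrite tens_epsE dag_ev !dag_epsE tens_etaE !dag_comp !whisk_l !comp_assoc.
rewrite (comp_under (lamT_nat_r _ _)) (comp_under (esym (assoc_nat_r _ _ _ _))).
rewrite !comp_assoc -(comp_assoc (aT _ _ _)) (comp_under (lamT_assoc_inv _ _ _)).
by rewrite !comp_assoc (comp_under (esym (interchange _ _ _))) -tmap_split.
Qed.

(** The dagger of [tens_pair d e] is, through [lamT] and [lamP], the tensor pair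
    of the daggers in the other order: its counit comes from the unit of
    [tens_pair d e], a composite whose dagger [dag_ev] identifies. *)
Lemma mates_lam P A Q B (d : dual_pair P A) (e : dual_pair Q B) :
  mates (tens_pair (dag_pair D e) (dag_pair D d)) (dag_pair D (tens_pair d e))
    (lamT D Q P) (lamP D A B)⁻¹.
Proof.
by rewrite /mates eps_dag_tens -comp_assoc -tmap_comp comp_idl bwd_fwd.
Qed.

(** [iota] is monoidal, so it carries [eps d] to the pairing of the double
    dagger of [d]. *)
Lemma mates_iota P A (d : dual_pair P A) :
  mates d (dag_pair D (dag_pair D d)) (iota D A) (iota D P)⁻¹.
Proof.
rewrite /mates dag_epsE /= !dag_comp !comp_assoc.
apply: (@iso_cancel_l _ _ _ _ (tmap_iso tensor (id_iso _) (iota D P))) => /=.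
rewrite -!comp_assoc -whisk_l fwd_bwd tmap_id comp_idl -interchange -tmap_split.
rewrite -iota_lamP !comp_assoc (comp_under (esym (dag_comp _ _ _))).
rewrite bwd_fwd dag_id comp_idl (comp_under (esym (iota_nat _ _))) comp_assoc.
by rewrite (comp_under (iota_bot _)) fwd_bwd comp_idr.
Qed.

Lemma mates_dag P A P' A' (d : linear_dual P A) (d' : linear_dual P' A')
    (f : hom A A') (m : hom P' P) :
  mates d d' f m -> mates (dag_pair D d) (dag_pair D d') m^† f^†.
Proof.
move=> /mates_eta h; rewrite /mates !dag_epsE -!comp_assoc; congr (_ · _).
by rewrite lamT_nat_r lamT_nat_l !comp_assoc -!dag_comp h.
Qed.

Lemma dag_right P A (d : linear_dual P A) :
  (uRT P†)⁻¹ · (1 ⊗₁ eta (dag_pair D d)) · dL P† A† P†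
    · (eps (dag_pair D d) ⊕₁ 1) · uLP P† = 1.
Proof.
have := dag_snake d; rewrite evE !comp_assoc => ->.
exact: bwd_fwd.
Qed.

End Dagger.

(** Dagger pairs commute with reversal up to conversion, which gives the other
    snake identity. *)
Definition dag_dual (X : ldc) (D : dagger X) (P A : X) (d : linear_dual P A) :
  linear_dual (dag D A) (dag D P) :=
  @LinearDual X _ _ (dag_pair D d)
    (@dag_right _ (dagger_rev D) _ _ (dual_rev d)) (dag_right D d).

Lemma mates_lam_par (X : ldc) (D : dagger X) (P A Q B : X)
    (d : dual_pair P A) (e : dual_pair Q B) :
  mates (par_pair (dag_pair D e) (dag_pair D d)) (dag_pair D (par_pair d e))
    (lamP D Q P) (lamT D A B)⁻¹.
Proof.
apply: (mates_inv (f := iso_inv (lamP D Q P)) (m := lamT D A B)).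
apply: mates_unrev.
exact: (@mates_lam _ (dagger_rev D) _ _ _ _ (pair_rev d) (pair_rev e)).
Qed.

(** * The left dual functor *)

Section LeftDual.
Variables (X : ldc) (S : star_autonomous X).
Implicit Types A B C : X.
Local Notation "A ^*" := (lstar S A) (at level 1, format "A ^*").
Local Notation "f ^*₁" := (lstar_map S f) (at level 1, format "f ^*₁").
Local Notation δ := (lstar_dual S).

Definition star_tens A B : iso (A ⊗ B)^* (B^* ⊕ A^*) :=
  left_dual_iso_iso (δ (A ⊗ B)) (tens_dual (δ A) (δ B)).

Definition star_par A B : iso (A ⊕ B)^* (B^* ⊗ A^*) :=
  left_dual_iso_iso (δ (A ⊕ B)) (par_dual (δ A) (δ B)).

Lemma mates_star A B (f : hom A B) : mates (δ A) (δ B) f f^*₁.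
Proof. exact: mates_left_mate. Qed.

Lemma star_id A : (idm A)^*₁ = 1.
Proof. exact: mates_unique (mates_star 1) (mates_id _). Qed.

Lemma star_comp A B C (f : hom A B) (g : hom B C) :
  (f · g)^*₁ = g^*₁ · f^*₁.
Proof.
exact: mates_unique (mates_star _) (mates_comp (mates_star f) (mates_star g)).
Qed.

Lemma mates_star_tens A B :
  mates (tens_pair (δ A) (δ B)) (δ (A ⊗ B)) 1 (star_tens A B).
Proof. exact: (mates_canonical _ (tens_dual _ _)). Qed.

Lemma mates_star_par A B :
  mates (par_pair (δ A) (δ B)) (δ (A ⊕ B)) 1 (star_par A B).
Proof. exact: (mates_canonical _ (par_dual _ _)). Qed.

Lemma mates_star_par_inv A B :
  mates (δ (A ⊕ B)) (par_pair (δ A) (δ B)) 1 (star_par A B)⁻¹.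
Proof. exact: (mates_canonical_inv _ (par_dual _ _)). Qed.

Lemma star_tens_nat A A' B B' (f : hom A A') (g : hom B B') :
  (f ⊗₁ g)^*₁ · star_tens A B = star_tens A' B' · (g^*₁ ⊕₁ f^*₁).
Proof.
apply: (@mates_unique _ _ _ _ _ (tens_dual (δ A) (δ B)) (δ (A' ⊗ B')) (f ⊗₁ g)).
- by apply: mates_comp_eq (mates_star_tens _ _) (mates_star _) _; rewrite comp_idl.
- apply: mates_comp_eq (mates_tens (mates_star f) (mates_star g)) (mates_star_tens _ _) _.
  by rewrite comp_idr.
Qed.

Lemma star_par_nat A A' B B' (f : hom A A') (g : hom B B') :
  (f ⊕₁ g)^*₁ · star_par A B = star_par A' B' · (g^*₁ ⊗₁ f^*₁).
Proof.
apply: (@mates_unique _ _ _ _ _ (par_dual (δ A) (δ B)) (δ (A' ⊕ B')) (f ⊕₁ g)).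
- by apply: mates_comp_eq (mates_star_par _ _) (mates_star _) _; rewrite comp_idl.
- apply: mates_comp_eq (mates_par (mates_star f) (mates_star g)) (mates_star_par _ _) _.
  by rewrite comp_idr.
Qed.

Lemma star_tens_assoc A B C :
  star_tens (A ⊗ B) C · (1 ⊕₁ star_tens A B) · (aP C^* B^* A^*)⁻¹
  = ((aT A B C)⁻¹)^*₁ · star_tens A (B ⊗ C) · (star_tens B C ⊕₁ 1).
Proof.
apply: (@mates_unique _ _ _ _ _ (tens_dual (δ A) (tens_dual (δ B) (δ C)))
  (δ ((A ⊗ B) ⊗ C)) (aT A B C)⁻¹).
- apply: mates_comp_eq (mates_inv (mates_assoc _ _ _)) _ (comp_idr _).
  apply: mates_comp_eq _ (mates_star_tens _ _) (comp_idr _).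
  rewrite -tmap_id; exact: mates_tens (mates_star_tens A B) (mates_id (δ C)).
- apply: mates_comp_eq _ (mates_comp (mates_star_tens _ _) (mates_star _)) _.
  + exact: mates_tens (mates_id (δ A)) (mates_star_tens B C).
  + by rewrite tmap_id !comp_idl.
Qed.

Lemma star_par_assoc A B C :
  star_par (A ⊕ B) C · (1 ⊗₁ star_par A B) · (aT C^* B^* A^*)⁻¹
  = ((aP A B C)⁻¹)^*₁ · star_par A (B ⊕ C) · (star_par B C ⊗₁ 1).
Proof.
apply: (@mates_unique _ _ _ _ _ (par_dual (δ A) (par_dual (δ B) (δ C)))
  (δ ((A ⊕ B) ⊕ C)) (aP A B C)⁻¹).
- apply: mates_comp_eq (mates_par_assoc _ _ _) _ (comp_idr _).
  apply: mates_comp_eq _ (mates_star_par _ _) (comp_idr _).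
  rewrite -tmap_id; exact: mates_par (mates_star_par A B) (mates_id (δ C)).
- apply: mates_comp_eq _ (mates_comp (mates_star_par _ _) (mates_star _)) _.
  + exact: mates_par (mates_id (δ A)) (mates_star_par B C).
  + by rewrite tmap_id !comp_idl.
Qed.

(** The left dual of [dL] is again [dL]: reversing the factors swaps [dL] with
    [dR], and so does reversing arrows while exchanging the tensors. *)
Lemma star_dL A B C :
  (star_par (A ⊗ B) C)⁻¹ · (dL A B C)^*₁ · star_tens A (B ⊕ C)
  = (1 ⊗₁ star_tens A B) · dL C^* B^* A^* · ((star_par B C)⁻¹ ⊕₁ 1).
Proof.
apply: (@mates_unique _ _ _ _ _ (tens_dual (δ A) (δ (B ⊕ C)))
  (par_dual (δ (A ⊗ B)) (δ C)) (dL A B C)).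
- apply: mates_comp_eq (mates_star_tens _ _) _ (comp_idl _).
  exact: mates_comp_eq (mates_star _) (mates_star_par_inv _ _) (comp_idr _).
- apply: mates_comp_eq (mates_tens (mates_id (δ A)) (mates_star_par_inv B C)) _ _.
    apply: mates_comp (mates_dL _ _ _) _.
    exact: mates_par (mates_star_tens A B) (mates_id (δ C)).
  by rewrite !tmap_id comp_idl comp_idr.
Qed.

Lemma star_dR A B C :
  (star_par A (B ⊗ C))⁻¹ · (dR A B C)^*₁ · star_tens (A ⊕ B) C
  = (star_tens B C ⊗₁ 1) · dR C^* B^* A^* · (1 ⊕₁ (star_par A B)⁻¹).
Proof.
apply: (@mates_unique _ _ _ _ _ (tens_dual (δ (A ⊕ B)) (δ C))
  (par_dual (δ A) (δ (B ⊗ C))) (dR A B C)).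
- apply: mates_comp_eq (mates_star_tens _ _) _ (comp_idl _).
  exact: mates_comp_eq (mates_star _) (mates_star_par_inv _ _) (comp_idr _).
- apply: mates_comp_eq (mates_tens (mates_star_par_inv A B) (mates_id (δ C))) _ _.
    apply: mates_comp (mates_dR _ _ _) _.
    exact: mates_par (mates_id (δ A)) (mates_star_tens B C).
  by rewrite !tmap_id comp_idl comp_idr.
Qed.

End LeftDual.

(** * The conjugation *)

Section Conjugation.
Variables (X : ldc) (D : dagger X) (S : star_autonomous X).
Implicit Types A B C : X.
Local Notation "A ^*" := (lstar S A) (at level 1, format "A ^*").
Local Notation "f ^*₁" := (lstar_map S f) (at level 1, format "f ^*₁").
Local Notation δ := (lstar_dual S).
Local Notation "A †" := (dag D A) (at level 1, format "A †").
Local Notation "f ^†" := (dag_map D f) (at level 1, format "f ^†").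

Definition bar A : X := A^*†.
Definition bar_map A B (f : hom A B) : hom (bar A) (bar B) := (f^*₁)^†.

Definition bar_tens A B : iso (bar A ⊗ bar B) (bar (B ⊗ A)) :=
  iso_comp (lamT D A^* B^*) (dag_iso D (star_tens S B A)).

(** Inverse in direction to the comparison for par in a conjugation: so
    oriented, it has the same shape as [bar_tens]. *)
Definition bar_par A B : iso (bar A ⊕ bar B) (bar (B ⊕ A)) :=
  iso_comp (lamP D A^* B^*) (dag_iso D (star_par S B A)).

Definition star_bar A : iso (bar A)^* A† :=
  left_dual_iso_iso (δ (bar A)) (dag_dual D (δ A)).

Definition bar_bar A : iso A (bar (bar A)) :=
  iso_comp (iota D A) (dag_iso D (star_bar A)).

Lemma mates_star_bar A :
  mates (dag_pair D (δ A)) (δ (bar A)) 1 (star_bar A).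
Proof. exact: (mates_canonical _ (dag_dual D _)). Qed.

Lemma bar_tensE A B :
  fwd (bar_tens A B) = lamT D A^* B^* · (star_tens S B A)^†.
Proof. by []. Qed.

Lemma bar_parE A B :
  fwd (bar_par A B) = lamP D A^* B^* · (star_par S B A)^†.
Proof. by []. Qed.

Lemma bar_par_invE A B :
  (bar_par A B)⁻¹ = (star_par S B A)⁻¹^† · (lamP D A^* B^*)⁻¹.
Proof. by []. Qed.

Lemma bar_barE A : fwd (bar_bar A) = iota D A · (star_bar A)^†.
Proof. by []. Qed.

Lemma bar_id A : bar_map (idm A) = 1.
Proof. by rewrite /bar_map star_id dag_id. Qed.

Lemma bar_comp A B C (f : hom A B) (g : hom B C) :
  bar_map (f · g) = bar_map f · bar_map g.
Proof. by rewrite /bar_map star_comp dag_comp. Qed.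

Lemma star_bar_nat A B (f : hom A B) :
  (bar_map f)^*₁ · star_bar A = star_bar B · f^†.
Proof.
apply: (@mates_unique _ _ _ _ _ (dag_dual D (δ A)) (δ (bar B)) (bar_map f)).
- exact: mates_comp_eq (mates_star_bar A) (mates_star S _) (comp_idl _).
- apply: mates_comp_eq _ (mates_star_bar B) (comp_idr _).
  exact: mates_dag (mates_star S f).
Qed.

Lemma bar_bar_nat A B (f : hom A B) :
  f · bar_bar B = bar_bar A · bar_map (bar_map f).
Proof.
rewrite !bar_barE -comp_assoc iota_nat !comp_assoc; congr (_ · _).
by rewrite -!dag_comp -star_bar_nat.
Qed.

Lemma bar_tens_nat A A' B B' (f : hom A A') (g : hom B B') :
  (bar_map f ⊗₁ bar_map g) · bar_tens A' B'
  = bar_tens A B · bar_map (g ⊗₁ f).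
Proof.
rewrite /bar_map !bar_tensE !comp_assoc -dag_comp star_tens_nat dag_comp.
by rewrite (comp_under (lamT_nat _ _ _)) comp_assoc.
Qed.

Lemma bar_par_nat A A' B B' (f : hom A A') (g : hom B B') :
  (bar_map f ⊕₁ bar_map g) · bar_par A' B'
  = bar_par A B · bar_map (g ⊕₁ f).
Proof.
rewrite /bar_map !bar_parE !comp_assoc -dag_comp star_par_nat dag_comp.
by rewrite (comp_under (lamP_nat _ _ _)) comp_assoc.
Qed.

Lemma bar_tens_assoc A B C :
  aT (bar A) (bar B) (bar C) · (1 ⊗₁ bar_tens B C) · bar_tens A (C ⊗ B)
  = (bar_tens A B ⊗₁ 1) · bar_tens (B ⊗ A) C · bar_map (aT C B A)⁻¹.
Proof.
rewrite /bar_map !bar_tensE whisk_l whisk_r !comp_assoc.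
rewrite (comp_under (lamT_nat_r _ _ _)) (comp_under (lamT_nat_l _ _ _)).
rewrite !comp_assoc -!dag_comp -star_tens_assoc !dag_comp.
by rewrite -!comp_assoc lamT_assoc_inv.
Qed.

Lemma bar_par_assoc A B C :
  aP (bar A) (bar B) (bar C) · (1 ⊕₁ bar_par B C) · bar_par A (C ⊕ B)
  = (bar_par A B ⊕₁ 1) · bar_par (B ⊕ A) C · bar_map (aP C B A)⁻¹.
Proof.
rewrite /bar_map !bar_parE whisk_l whisk_r !comp_assoc.
rewrite (comp_under (lamP_nat_r _ _ _)) (comp_under (lamP_nat_l _ _ _)).
rewrite !comp_assoc -!dag_comp -star_par_assoc !dag_comp.
by rewrite -!comp_assoc lamP_assoc_inv.
Qed.

Lemma bar_dR A B C :
  ((bar_par C B)⁻¹ ⊗₁ 1) · dR (bar C) (bar B) (bar A) · (1 ⊕₁ bar_tens B A)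
  = bar_tens (B ⊕ C) A · bar_map (dL A B C) · (bar_par C (A ⊗ B))⁻¹.
Proof.
rewrite /bar_map !bar_tensE !bar_par_invE whisk_r whisk_l !comp_assoc.
rewrite -!(comp_assoc _ (dR _ _ _)) -!(comp_assoc _ _ (1 ⊕₁ _^†)).
rewrite dag_dL !comp_assoc lamP_inv_nat_r.
rewrite (comp_under (lamT_nat_l _ _ _)) !comp_assoc.
rewrite !(comp_under (esym (dag_comp _ _ _))).
by rewrite -[X in _ = _ · (X^† · _)]comp_assoc star_dL !comp_assoc.
Qed.

Lemma bar_dL A B C :
  (1 ⊗₁ (bar_par B C)⁻¹) · dL (bar A) (bar B) (bar C) · (bar_tens A B ⊕₁ 1)
  = bar_tens A (C ⊕ B) · bar_map (dR C B A) · (bar_par (B ⊗ A) C)⁻¹.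
Proof.
rewrite /bar_map !bar_tensE !bar_par_invE whisk_r whisk_l !comp_assoc.
rewrite -!(comp_assoc _ (dL _ _ _)) -!(comp_assoc _ _ (_^† ⊕₁ 1)).
rewrite dag_dR !comp_assoc lamP_inv_nat_l.
rewrite (comp_under (lamT_nat_r _ _ _)) !comp_assoc.
rewrite !(comp_under (esym (dag_comp _ _ _))).
by rewrite -[X in _ = _ · (X^† · _)]comp_assoc star_dR !comp_assoc.
Qed.

(** What [bar_bar_tens] asks of the left duals once its daggers are removed. *)
Lemma star_bar_tens A B :
  (bar_tens B A)^*₁ · star_tens S (bar B) (bar A)
    · (star_bar A ⊕₁ star_bar B) = star_bar (A ⊗ B) · (lamP D A B)⁻¹.
Proof.
apply: (@mates_unique _ _ _ _ _ (tens_dual (dag_dual D (δ B)) (dag_dual D (δ A)))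
  (δ (bar (A ⊗ B))) (bar_tens B A)).
- have h := mates_tens (mates_star_bar B) (mates_star_bar A).
  apply: mates_comp_eq h _ _.
    exact: mates_comp (mates_star_tens _ _ _) (mates_star _ _).
  by rewrite tmap_id !comp_idl.
- have h := mates_dag D (d := tens_dual (δ A) (δ B)) (mates_star_tens S A B).
  have := mates_comp h (mates_star_bar (A ⊗ B)); rewrite dag_id !comp_idr.
  exact: mates_comp (mates_lam D (δ A) (δ B)).
Qed.

Lemma bar_bar_tens A B :
  (bar_bar A ⊗₁ bar_bar B) · bar_tens (bar A) (bar B) · bar_map (bar_tens B A)
  = bar_bar (A ⊗ B).
Proof.
rewrite /bar_map bar_tensE !bar_barE (tmap_comp tensor) !comp_assoc.
rewrite (comp_under (lamT_nat _ _ _)) !comp_assoc.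
rewrite -!dag_comp -comp_assoc star_bar_tens dag_comp.
rewrite -iota_lamP comp_assoc (comp_under (esym (dag_comp _ _ _))).
by rewrite bwd_fwd dag_id comp_idl.
Qed.

Lemma star_bar_par A B :
  (bar_par B A)^*₁ · star_par S (bar B) (bar A)
    · (star_bar A ⊗₁ star_bar B) = star_bar (A ⊕ B) · (lamT D A B)⁻¹.
Proof.
apply: (@mates_unique _ _ _ _ _ (par_dual (dag_dual D (δ B)) (dag_dual D (δ A)))
  (δ (bar (A ⊕ B))) (bar_par B A)).
- have h := mates_par (mates_star_bar B) (mates_star_bar A).
  apply: mates_comp_eq h _ _.
    exact: mates_comp (mates_star_par _ _ _) (mates_star _ _).
  by rewrite tmap_id !comp_idl.
- have h := mates_dag D (d := par_dual (δ A) (δ B)) (mates_star_par S A B).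
  have := mates_comp h (mates_star_bar (A ⊕ B)); rewrite dag_id !comp_idr.
  exact: mates_comp (mates_lam_par D (δ A) (δ B)).
Qed.

Lemma bar_bar_par A B :
  (bar_bar A ⊕₁ bar_bar B) · bar_par (bar A) (bar B) · bar_map (bar_par B A)
  = bar_bar (A ⊕ B).
Proof.
rewrite /bar_map bar_parE !bar_barE (tmap_comp par) !comp_assoc.
rewrite (comp_under (lamP_nat _ _ _)) !comp_assoc.
rewrite -!dag_comp -comp_assoc star_bar_par dag_comp.
rewrite -iota_lamT comp_assoc (comp_under (esym (dag_comp _ _ _))).
by rewrite bwd_fwd dag_id comp_idl.
Qed.

(** As [iota] at [bar A] is the dagger of the inverse of [iota] at [A^*], both
    sides are daggers, of the two mates of [bar_bar A] compared in [key]. *)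
Lemma bar_bar_bar A : bar_map (bar_bar A) = bar_bar (bar A).
Proof.
have key : (bar_bar A)^*₁ = star_bar (bar A) · (iota D A^*)⁻¹.
  apply: (@mates_unique _ _ _ _ _ (δ A) (δ (bar (bar A))) (bar_bar A)).
    exact: mates_star.
  apply: mates_comp_eq _ (mates_star_bar (bar A)) (comp_idr _).
  have h := mates_dag D (d := dag_dual D (δ A)) (mates_star_bar A).
  have := mates_comp (mates_iota D (δ A)) h.
  by rewrite dag_id comp_idl.
by rewrite /bar_map key dag_comp -iota_dag.
Qed.

Definition bar_conjugation : conjugation X.
Proof.
refine (@Conjugation X bar bar_map _ _ bar_tens
  (fun A B => iso_inv (bar_par B A)) (fun A => iso_inv (bar_bar A))
  _ _ _ _ _ _ _ _ _ _).
- exact: bar_id.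
- exact: bar_comp.
- by move=> *; apply: bar_tens_nat.
- by move=> A A' B B' f g; apply: iso_inv_square; rewrite bar_par_nat.
- by move=> A B f; apply: iso_inv_square; rewrite bar_bar_nat.
- move=> A; apply: (@iso_cancel_l _ _ _ _ (bar_bar (bar A))).
  by rewrite fwd_bwd -bar_bar_bar -bar_comp fwd_bwd bar_id.
- exact: bar_tens_assoc.
- by move=> A B; apply: tmap_inv_square; rewrite -comp_assoc; apply: bar_bar_tens.
- exact: bar_par_assoc.
- by move=> A B; apply: tmap_inv_square; rewrite -comp_assoc; apply: bar_bar_par.
- exact: bar_dR.
- exact: bar_dL.
Defined.

End Conjugation.

Theorem theorem4p11 (X : ldc) (H : cyclic_dagger_star_autonomous X) :
  exists K : conjugative_star_autonomous X, csa_star K = cdsa_star H.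
Proof.
by exists (ConjugativeStarAutonomous
  (bar_conjugation (cdsa_dagger H) (cdsa_star H)) (cdsa_star H)).
Qed.
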